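(* Let $\mathcal{C}$ and $\mathcal{E}$ be small $\infty$-categories and let $\mathcal{D}$ be a presentable $\infty$-category. For a small $\infty$-category $\mathcal{A}$ write $\int^{\mathcal{A}} : \mathrm{Fun}(\mathcal{A}^{\mathrm{op}}\times\mathcal{A},\mathcal{X})\to\mathcal{X}$ for the coend functor, where $\mathcal{X}$ is any $\infty$-category with small colimits. Consider the following three functors $\mathrm{Fun}(\mathcal{C}^{\mathrm{op}}\times\mathcal{C}\times\mathcal{E}^{\mathrm{op}}\times\mathcal{E},\mathcal{D})\to\mathcal{D}$. 1. $\iint^{CE}$ is the composite $$\mathrm{Fun}(\mathcal{C}^{\mathrm{op}}\times\mathcal{C}\times\mathcal{E}^{\mathrm{op}}\times\mathcal{E},\mathcal{D})\cong \mathrm{Fun}\big(\mathcal{C}^{\mathrm{op}}\times\mathcal{C},\mathrm{Fun}(\mathcal{E}^{\mathrm{op}}\times\mathcal{E},\mathcal{D})\big)\to \mathrm{Fun}(\mathcal{C}^{\mathrm{op}}\times\mathcal{C},\mathcal{D})\xrightarrow{\int^{\mathcal{C}}}\mathcal{D},$$ where the middle arrow is postcomposition with $\int^{\mathcal{E}}:\mathrm{Fun}(\mathcal{E}^{\mathrm{op}}\times\mathcal{E},\mathcal{D})\to\mathcal{D}$. 2. $\iint^{EC}$ is the composite $$\mathrm{Fun}(\mathcal{C}^{\mathrm{op}}\times\mathcal{C}\times\mathcal{E}^{\mathrm{op}}\times\mathcal{E},\mathcal{D})\cong \mathrm{Fun}\big(\mathcal{E}^{\mathrm{op}}\times\mathcal{E},\mathrm{Fun}(\mathcal{C}^{\mathrm{op}}\times\mathcal{C},\mathcal{D})\big)\to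 \mathrm{Fun}(\mathcal{E}^{\mathrm{op}}\times\mathcal{E},\mathcal{D})\xrightarrow{\int^{\mathcal{E}}}\mathcal{D},$$ where the middle arrow is postcomposition with $\int^{\mathcal{C}}:\mathrm{Fun}(\mathcal{C}^{\mathrm{op}}\times\mathcal{C},\mathcal{D})\to\mathcal{D}$. 3. $\int^{(C,E)}$ is the composite $$\mathrm{Fun}(\mathcal{C}^{\mathrm{op}}\times\mathcal{C}\times\mathcal{E}^{\mathrm{op}}\times\mathcal{E},\mathcal{D})\cong \mathrm{Fun}\big((\mathcal{C}\times\mathcal{E})^{\mathrm{op}}\times(\mathcal{C}\times\mathcal{E}),\mathcal{D}\big)\xrightarrow{\int^{\mathcal{C}\times\mathcal{E}}}\mathcal{D}.$$ Then the functors $\iint^{CE}$, $\iint^{EC}$ and $\int^{(C,E)}$ are naturally isomorphic (i.e. equivalent as objects of the $\infty$-category of functors $\mathrm{Fun}(\mathcal{C}^{\mathrm{op}}\times\mathcal{C}\times\mathcal{E}^{\mathrm{op}}\times\mathcal{E},\mathcal{D})\to\mathcal{D}$). In particular, for every functor $F:\mathcal{C}^{\mathrm{op}}\times\mathcal{C}\times\mathcal{E}^{\mathrm{op}}\times\mathcal{E}\to\mathcal{D}$ their values at $F$ are canonically isomorphic.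
   Context: $\infty$-categories are quasi-categories, and $\mathrm{Fun}(\mathcal{X},\mathcal{Y})$ (written $[\mathcal{X},\mathcal{Y}]$ in the paper) is the functor $\infty$-category. Twisted arrow $\infty$-category: let $\epsilon:\boldsymbol{\Delta}\to\boldsymbol{\Delta}$ be the functor $[n]\mapsto[n]\star[n]^{\mathrm{op}}$ (join). For an $\infty$-category $\mathcal{A}$, $\mathrm{Tw}(\mathcal{A}):=\epsilon^*\mathcal{A}$ is the simplicial set whose $n$-simplices are the maps of simplicial sets $\Delta^n\star(\Delta^n)^{\mathrm{op}}\to\mathcal{A}$; it is an $\infty$-category. The inclusions of $[n]$ and $[n]^{\mathrm{op}}$ into the join induce a right fibration $\mathrm{Tw}(\mathcal{A})\to\mathcal{A}\times\mathcal{A}^{\mathrm{op}}$, sending an object $f:x\to y$ to $(x,y)$, classified by $\mathrm{Map}_{\mathcal{A}}:\mathcal{A}^{\mathrm{op}}\times\mathcal{A}\to\mathcal{S}$, where $\mathcal{S}$ is the $\infty$-category of spaces. Let $\Sigma_{\mathcal{A}}:\mathrm{Tw}(\mathcal{A})\to\mathcal{A}^{\mathrm{op}}\times\mathcal{A}$ be its composite with the swap $\mathcal{A}\times\mathcal{A}^{\mathrm{op}}\cong\mathcal{A}^{\mathrm{op}}\times\mathcal{A}$, so that $f:x\to y$ is sent to $(y,x)$. Coend: for $G:\mathcal{A}^{\mathrm{op}}\times\mathcal{A}\to\mathcal{X}$ with $\mathcal{A}$ small and $\mathcal{X}$ having small colimits, $\int^{\mathcal{A}}G:=\operatorname{colim}_{\mathrm{Tw}(\mathcal{A})}(G\circ\Sigma_{\mathcal{A}})$.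 The coend functor is $\int^{\mathcal{A}}=\operatorname{colim}_{\mathrm{Tw}(\mathcal{A})}\circ\,\Sigma_{\mathcal{A}}^*$, where $\Sigma_{\mathcal{A}}^*$ is precomposition with $\Sigma_{\mathcal{A}}$. *)

(* Defs.v *)
From mathcomp Require Import all_boot zify.
From Stdlib Require Import FunctionalExtensionality ProofIrrelevance.

Set Implicit Arguments.
Unset Strict Implicit.
Unset Printing Implicit Defensive.

(* The universe of small types.  The simplices of an arbitrary simplicial set
   live in a strictly larger universe. *)
Definition SmallType := Type.

(* Monotone maps [m] -> [n], with [n] = 'I_n.+1.  With primitive projections,
   composition is associative and unital up to conversion. *)
Set Primitive Projections.
Record hom (m n : nat) := Hom {
  hfun :> 'I_m.+1 -> 'I_n.+1;
  hmono : forall i j : 'I_m.+1, i <= j -> hfun i <= hfun j }.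
Unset Primitive Projections.

Lemma hom_eq m n (f g : hom m n) : (forall i, f i = g i) -> f = g.
Proof.
case: f g => f hf [g hg] /= e.
have efg : f = g by apply: functional_extensionality.
by subst g; rewrite (proof_irrelevance _ hf hg).
Qed.

Definition idh n : hom n n := Hom (fun i j (h : i <= j) => h).

Definition comph l m n (f : hom m n) (g : hom l m) : hom l n :=
  @Hom l n (fun i => f (g i)) (fun i j h => hmono f (hmono g h)).

Definition consth m n (i : 'I_n.+1) : hom m n :=
  @Hom m n (fun=> i) (fun _ _ _ => leqnn i).

Lemma face_mono n (i : 'I_n.+2) (j k : 'I_n.+1) :
  j <= k -> lift i j <= lift i k.
Proof. by move=> h; rewrite /= leq_bump2. Qed.

Definition face n (i : 'I_n.+2) : hom n n.+1 := Hom (@face_mono n i).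

Lemma rev_mono m n (f : hom m n) (i j : 'I_m.+1) :
  i <= j -> rev_ord (f (rev_ord i)) <= rev_ord (f (rev_ord j)).
Proof.
move=> h; have : f (rev_ord j) <= f (rev_ord i).
  by apply: hmono; rewrite /= leq_sub2l.
by move=> h'; rewrite /= leq_sub2l.
Qed.

(* f^op : [m]^op -> [n]^op, with [n]^op identified with [n] by i |-> n - i. *)
Definition revh m n (f : hom m n) : hom m n := Hom (@rev_mono m n f).

Lemma revh_id n : revh (idh n) = idh n.
Proof. by apply: hom_eq => i; rewrite /= rev_ordK. Qed.

Lemma revh_comp l m n (f : hom m n) (g : hom l m) :
  revh (comph f g) = comph (revh f) (revh g).
Proof. by apply: hom_eq => i; rewrite /= rev_ordK. Qed.

(* epsilon [n] = [n] * [n]^op, whose underlying set is 'I_(n.+1 + n.+1): the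
   left summand is [n], and the element j of the right summand is the element
   n - j of [n]^op. *)
Definition eps (n : nat) : nat := n + n.+1.

Definition eps_fun m n (f : hom m n) (i : 'I_(m.+1 + m.+1)) :
    'I_(n.+1 + n.+1) :=
  match split i with
  | inl a => lshift n.+1 (f a)
  | inr b => rshift n.+1 (revh f b)
  end.

Lemma eps_mono m n (f : hom m n) (i j : 'I_(m.+1 + m.+1)) :
  i <= j -> eps_fun f i <= eps_fun f j.
Proof.
rewrite /eps_fun; case: splitP => a ->; case: splitP => b -> h.
- exact: (hmono f).
- by apply: (leq_trans (ltnW (ltn_ord (f a)))); exact: leq_addr.
- by have := ltn_ord b; lia.
- by rewrite leq_add2l in h; move: (hmono (revh f) h); rewrite -(leq_add2l n.+1).
Qed.

Definition epsh m n (f : hom m n) : hom (eps m) (eps n) :=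
  @Hom (eps m) (eps n) (eps_fun f) (@eps_mono m n f).

Lemma epsh_id n : epsh (idh n) = idh (eps n).
Proof.
apply: hom_eq => i; apply: val_inj; rewrite /= /eps_fun.
by case: splitP => a -> //=; have := ltn_ord a; lia.
Qed.

Lemma eps_funl m n (f : hom m n) a :
  eps_fun f (lshift m.+1 a) = lshift n.+1 (f a).
Proof. by rewrite /eps_fun (unsplitK (inl a)). Qed.

Lemma eps_funr m n (f : hom m n) a :
  eps_fun f (rshift m.+1 a) = rshift n.+1 (revh f a).
Proof. by rewrite /eps_fun (unsplitK (inr a)). Qed.

Lemma epsh_comp l m n (f : hom m n) (g : hom l m) :
  epsh (comph f g) = comph (epsh f) (epsh g).
Proof.
apply: hom_eq => i; change (eps_fun (comph f g) i = eps_fun f (eps_fun g i)).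
rewrite -(@splitK l.+1 l.+1 i); case: (@split l.+1 l.+1 i) => a /=.
- by rewrite !eps_funl.
- by rewrite !eps_funr revh_comp.
Qed.

Lemma head_mono n (i j : 'I_n.+1) : i <= j -> lshift n.+1 i <= lshift n.+1 j.
Proof. by []. Qed.

Lemma tail_mono n (i j : 'I_n.+1) : i <= j -> rshift n.+1 i <= rshift n.+1 j.
Proof. by move=> h; rewrite /= leq_add2l. Qed.

Definition headh n : hom n (eps n) := @Hom n (eps n) _ (@head_mono n).
Definition tailh n : hom n (eps n) := @Hom n (eps n) _ (@tail_mono n).

Lemma epsh_head m n (f : hom m n) :
  comph (epsh f) (headh m) = comph (headh n) f.
Proof. by apply: hom_eq => i; exact: eps_funl. Qed.

Lemma epsh_tail m n (f : hom m n) :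
  comph (epsh f) (tailh m) = comph (tailh n) (revh f).
Proof. by apply: hom_eq => i; exact: eps_funr. Qed.

Record sset := SSet {
  simp :> nat -> Type;
  act : forall m n, hom m n -> simp n -> simp m;
  act_id : forall n (x : simp n), act (idh n) x = x;
  act_comp : forall l m n (f : hom m n) (g : hom l m) (x : simp n),
    act (comph f g) x = act g (act f x) }.

Arguments act {s m n}.

Record smap (X Y : sset) := SMap {
  app :> forall n, X n -> Y n;
  app_nat : forall m n (f : hom m n) (x : X n),
    app (act f x) = act f (app x) }.

Lemma smap_eq X Y (f g : smap X Y) : (forall n x, f n x = g n x) -> f = g.
Proof.
case: f g => f hf [g hg] /= e.
have efg : f = g.
  apply: functional_extensionality_dep => n.
  by apply: functional_extensionality => x.
by subst g; rewrite (proof_irrelevance _ hf hg).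
Qed.

Program Definition sid (X : sset) : smap X X := @SMap X X (fun n x => x) _.

Program Definition scomp (X Y Z : sset) (g : smap Y Z) (f : smap X Y) :
  smap X Z := @SMap X Z (fun n x => g n (f n x)) _.
Next Obligation. by rewrite !app_nat. Qed.

Lemma sig_eq (T : Type) (P : T -> Prop) (a b : sig P) :
  proj1_sig a = proj1_sig b -> a = b.
Proof.
case: a b => a ha [b hb] /= e; subst b.
by rewrite (proof_irrelevance _ ha hb).
Qed.

Section SubSimplicialSet.
Variables (X : sset) (P : forall n, X n -> Prop).
Hypothesis Pact : forall m n (f : hom m n) (x : X n), P x -> P (act f x).

Program Definition ssub : sset := @SSet (fun n => {x : X n | P x})
  (fun m n f x => exist _ (act f (proj1_sig x)) (Pact f (proj2_sig x))) _ _.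
Next Obligation. by apply: sig_eq; rewrite /= act_id. Qed.
Next Obligation. by apply: sig_eq; rewrite /= act_comp. Qed.

Program Definition ssub_incl : smap ssub X :=
  @SMap ssub X (fun n x => proj1_sig x) _.
End SubSimplicialSet.

Definition Delta (n : nat) : sset := @SSet (fun m => hom m n)
  (fun l m g f => comph f g) (fun _ _ => erefl) (fun _ _ _ _ _ _ => erefl).

Definition DeltaMap m n (f : hom m n) : smap (Delta m) (Delta n) :=
  @SMap (Delta m) (Delta n) (fun l g => comph f g) (fun _ _ _ _ => erefl).

Program Definition op (X : sset) : sset :=
  @SSet X (fun m n f x => act (revh f) x) _ _.
Next Obligation. by rewrite revh_id act_id. Qed.
Next Obligation. by rewrite revh_comp act_comp. Qed.

Program Definition Prod (X Y : sset) : sset :=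
  @SSet (fun n => X n * Y n)%type (fun m n f x => (act f x.1, act f x.2)) _ _.
Next Obligation. by rewrite !act_id. Qed.
Next Obligation. by rewrite !act_comp. Qed.

Program Definition sfst X Y : smap (Prod X Y) X :=
  @SMap (Prod X Y) X (fun n x => x.1) _.
Program Definition ssnd X Y : smap (Prod X Y) Y :=
  @SMap (Prod X Y) Y (fun n x => x.2) _.
Program Definition spair Z X Y (f : smap Z X) (g : smap Z Y) :
  smap Z (Prod X Y) := @SMap Z (Prod X Y) (fun n z => (f n z, g n z)) _.
Next Obligation. by rewrite !app_nat. Qed.

Definition sprod X X' Y Y' (f : smap X X') (g : smap Y Y') :
    smap (Prod X Y) (Prod X' Y') :=
  spair (scomp f (sfst X Y)) (scomp g (ssnd X Y)).

(* The n-simplices of Fun X Y are the maps Delta n x X -> Y. *)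
Program Definition Fun (X Y : sset) : sset :=
  @SSet (fun n => smap (Prod (Delta n) X) Y)
    (fun m n f h => scomp h (sprod (DeltaMap f) (sid X))) _ _.
Next Obligation. by apply: smap_eq => k [a b]. Qed.
Next Obligation. by apply: smap_eq => k [a b]. Qed.

Program Definition precomp X X' (f : smap X X') (Y : sset) :
    smap (Fun X' Y) (Fun X Y) :=
  @SMap (Fun X' Y) (Fun X Y)
    (fun n h => scomp h (sprod (sid (Delta n)) f)) _.
Next Obligation. by apply: smap_eq => k [a b]. Qed.

Program Definition postcomp (X Y Y' : sset) (g : smap Y Y') :
    smap (Fun X Y) (Fun X Y') :=
  @SMap (Fun X Y) (Fun X Y') (fun n h => scomp g h) _.
Next Obligation. by apply: smap_eq => k [a b]. Qed.

Arguments postcomp X {Y Y'} g.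

Section Curry.
Variables X Y Z : sset.

Program Definition curry_at n (h : Fun (Prod X Y) Z n) m
    (ax : Prod (Delta n) X m) : Fun Y Z m :=
  @SMap (Prod (Delta m) Y) Z
    (fun k by_ => h k (comph ax.1 by_.1, (act by_.1 ax.2, by_.2))) _.
Next Obligation.
by rewrite -(app_nat h) /= act_comp.
Qed.

Program Definition curry_simplex n (h : Fun (Prod X Y) Z n) :
    Fun X (Fun Y Z) n :=
  @SMap (Prod (Delta n) X) (Fun Y Z) (fun m ax => curry_at h ax) _.
Next Obligation.
by apply: smap_eq => k [b y] /=; rewrite act_comp.
Qed.

Program Definition curry : smap (Fun (Prod X Y) Z) (Fun X (Fun Y Z)) :=
  @SMap (Fun (Prod X Y) Z) (Fun X (Fun Y Z)) (fun n h => curry_simplex h) _.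
Next Obligation.
by apply: smap_eq => k [a b]; apply: smap_eq => l [c d].
Qed.
End Curry.

Definition small (X : sset) : Prop :=
  forall n, exists T : SmallType, exists f : T -> X n, bijective f.

Program Definition horn n (k : 'I_n.+1) : sset :=
  @ssub (Delta n)
    (fun m (f : hom m n) => exists2 j, j != k & forall i, f i != j) _.
Next Obligation. by exists H => // i; exact: H1. Qed.

Definition horn_incl n (k : 'I_n.+1) : smap (horn k) (Delta n) :=
  ssub_incl _.

Program Definition boundary n : sset :=
  @ssub (Delta n) (fun m (f : hom m n) => exists j, forall i, f i != j) _.
Next Obligation. by exists H => i; exact: H0. Qed.

Definition boundary_incl n : smap (boundary n) (Delta n) := ssub_incl _.

Definition quasicat (X : sset) : Prop :=
  forall n (k : 'I_n.+1), 0 < k < n ->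
  forall u : smap (horn k) X,
  exists w : smap (Delta n) X, scomp w (horn_incl k) = u.

Definition left_fibration X Y (p : smap X Y) : Prop :=
  forall n (k : 'I_n.+1), k < n ->
  forall (u : smap (horn k) X) (v : smap (Delta n) Y),
  scomp p u = scomp v (horn_incl k) ->
  exists w : smap (Delta n) X, scomp w (horn_incl k) = u /\ scomp p w = v.

(* For n = 0 this says that X has a vertex. *)
Definition contractible_kan (X : sset) : Prop :=
  forall n (u : smap (boundary n) X),
  exists w : smap (Delta n) X, scomp w (boundary_incl n) = u.

Definition is_edge (X : sset) (x y : X 0) (e : X 1) : Prop :=
  act (face ord_max) e = x /\ act (face ord0) e = y.

Definition id_edge (X : sset) (x : X 0) : X 1 := act (consth 1 ord0) x.

(* Some 2-simplex exhibits h as a composite of f followed by g. *)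
Definition composes (X : sset) (f g h : X 1) : Prop :=
  exists t : X 2, [/\ act (face ord_max) t = f, act (face ord0) t = g
                    & act (face (lift ord0 ord0)) t = h].

Definition is_equiv (X : sset) (x y : X 0) (e : X 1) : Prop :=
  is_edge x y e /\
  exists e' : X 1, [/\ is_edge y x e', composes e e' (id_edge x)
                     & composes e' e (id_edge y)].

(* A functor X -> Y seen as an object of Fun X Y. *)
Definition vert X Y (f : smap X Y) : Fun X Y 0 := scomp f (ssnd (Delta 0) X).

(* The value at z : Z 0 of a natural transformation e : Fun Z X 1. *)
Definition component (Z X : sset) (e : Fun Z X 1) (z : Z 0) : X 1 :=
  e 1 (idh 1, act (consth 1 ord0) z).

Definition cat_equiv (X Y : sset) : Prop :=
  exists (f : smap X Y) (g : smap Y X) (a : Fun X X 1) (b : Fun Y Y 1),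
    is_equiv (vert (sid X)) (vert (scomp g f)) a /\
    is_equiv (vert (scomp f g)) (vert (sid Y)) b.

(* The space of maps from x to y: the fibre over (x, y) of
   Fun (Delta 1) X -> X x X. *)
Program Definition MapSpace (X : sset) (x y : X 0) : sset :=
  @ssub (Fun (Delta 1) X)
    (fun n (h : smap (Prod (Delta n) (Delta 1)) X) =>
       forall m (t : hom m n),
         h m (t, consth m ord0) = act (consth m ord0) x /\
         h m (t, consth m ord_max) = act (consth m ord0) y) _.

Definition initial (X : sset) (x : X 0) : Prop :=
  forall y : X 0, contractible_kan (MapSpace x y).

(* An n-simplex of X * Y is a map c : Delta n -> Delta 1 together with a map
   to X from the part of Delta n lying over the vertex 0, and a map to Y from
   the part lying over the vertex 1.  Either part may be empty. *)
Section Join.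
Variables X Y : sset.

Record join_simplex (n : nat) := JoinSimplex {
  cut : hom n 1;
  jl : forall m (f : hom m n), (forall i, cut (f i) = 0 :> nat) -> X m;
  jl_nat : forall l m (f : hom m n) (g : hom l m) h h',
    jl (f := comph f g) h' = act g (jl (f := f) h);
  jr : forall m (f : hom m n), (forall i, cut (f i) = 1 :> nat) -> Y m;
  jr_nat : forall l m (f : hom m n) (g : hom l m) h h',
    jr (f := comph f g) h' = act g (jr (f := f) h) }.

Lemma join_simplex_eq n (a b : join_simplex n) :
  cut a = cut b ->
  (forall m (f : hom m n) h h', @jl n a m f h = @jl n b m f h') ->
  (forall m (f : hom m n) h h', @jr n a m f h = @jr n b m f h') ->
  a = b.
Proof.
case: a b => c l ln r rn [c' l' ln' r' rn'] /= e el er; subst c'.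
have ell : l = l'.
  apply: functional_extensionality_dep => m.
  apply: functional_extensionality_dep => f.
  by apply: functional_extensionality => h.
have err : r = r'.
  apply: functional_extensionality_dep => m.
  apply: functional_extensionality_dep => f.
  by apply: functional_extensionality => h.
subst l' r'.
by rewrite (proof_irrelevance _ ln ln') (proof_irrelevance _ rn rn').
Qed.

Definition join_act m n (f : hom m n) (a : join_simplex n) : join_simplex m :=
  @JoinSimplex m (comph (cut a) f)
    (fun k g h => @jl n a k (comph f g) h)
    (fun k l g g' h h' => @jl_nat n a k l (comph f g) g' h h')
    (fun k g h => @jr n a k (comph f g) h)
    (fun k l g g' h h' => @jr_nat n a k l (comph f g) g' h h').

Program Definition join : sset := @SSet join_simplex join_act _ _.
Next Obligation.
by apply: join_simplex_eq => //= m f h h'; rewrite (proof_irrelevance _ h h').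
Qed.

Program Definition inl_simplex n (x : X n) : join_simplex n :=
  @JoinSimplex n (consth n ord0) (fun m f _ => act f x) _
    (fun m f h => False_rect _ _) _.
Next Obligation. by rewrite act_comp. Qed.
Next Obligation. by have := h ord0. Qed.
Next Obligation. by have := h ord0. Qed.

Program Definition join_inl : smap X join := @SMap X join inl_simplex _.
Next Obligation.
apply: join_simplex_eq => //= k g h h'; first by rewrite act_comp.
by have := h ord0.
Qed.
End Join.

Program Definition join_mapr_simplex X Y Y' (g : smap Y Y') n
    (a : join X Y n) : join X Y' n :=
  @JoinSimplex X Y' n (cut a) (@jl _ _ _ a) (@jl_nat _ _ _ a)
    (fun m f h => g m (@jr _ _ _ a m f h)) _.
Next Obligation. by rewrite (jr_nat h) app_nat. Qed.

Program Definition join_mapr X Y Y' (g : smap Y Y') :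
    smap (join X Y) (join X Y') :=
  @SMap (join X Y) (join X Y') (join_mapr_simplex g) _.
Next Obligation.
by apply: join_simplex_eq => //= k f' h h'; rewrite (proof_irrelevance _ h h').
Qed.

Arguments join_mapr X {Y Y'} g.

Section Under.
Variables (K X : sset) (p : smap K X).

Program Definition join_maps : sset :=
  @SSet (fun n => smap (join K (Delta n)) X)
    (fun m n f h => scomp h (join_mapr K (DeltaMap f))) _ _.
Next Obligation.
apply: smap_eq => k a /=; congr (x _ _).
by apply: join_simplex_eq => //= l f h h'; rewrite (proof_irrelevance _ h h').
Qed.
Next Obligation.
apply: smap_eq => k a /=; congr (x _ _).
by apply: join_simplex_eq => //= j f' h h'; rewrite (proof_irrelevance _ h h').
Qed.

(* X_{p/}: its n-simplices are the maps K * Delta n -> X extending p. *)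
Program Definition Under : sset :=
  @ssub join_maps
    (fun n (h : smap (join K (Delta n)) X) => scomp h (join_inl K (Delta n)) = p)
    _.
Next Obligation.
apply: smap_eq => k a /=; congr (x _ _).
by apply: join_simplex_eq => //= j f' h; have := h ord0.
Qed.
End Under.

Definition has_small_colimits (X : sset) : Prop :=
  forall K : sset, small K -> forall p : smap K X,
  exists c : Under p 0, initial c.

Definition adjoint X Y (f : smap X Y) (g : smap Y X) : Prop :=
  exists (eta : Fun X X 1) (epsilon : Fun Y Y 1),
    [/\ is_edge (vert (sid X)) (vert (scomp g f)) eta,
        is_edge (vert (scomp f g)) (vert (sid Y)) epsilon,
        composes (postcomp X f 1 eta) (precomp f Y 1 epsilon)
                 (id_edge (vert f))
      & composes (precomp g X 1 eta) (postcomp Y g 1 epsilon)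
                 (id_edge (vert g))].

Program Definition diagonal (K X : sset) : smap X (Fun K X) :=
  @SMap X (Fun K X)
    (fun n x => @SMap (Prod (Delta n) K) X (fun m t => act t.1 x) _) _.
Next Obligation. by rewrite act_comp. Qed.
Next Obligation. by apply: smap_eq => k [a b] /=; rewrite act_comp. Qed.

Definition colimit_functor (K X : sset) (colim : smap (Fun K X) X) : Prop :=
  adjoint colim (diagonal K X).

(* Presheaves of small types on the category of simplices of Delta n. *)
Set Primitive Projections.
Record bundle (n : nat) := Bundle {
  fib : forall m, hom m n -> SmallType;
  tr : forall l m (f : hom m n) (g : hom l m), fib f -> fib (comph f g);
  tr_id : forall m (f : hom m n) (s : fib f), tr (idh m) s = s;
  tr_comp : forall k l m (f : hom m n) (g : hom l m) (g' : hom k l)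
    (s : fib f), tr (comph g g') s = tr g' (tr g s) }.
Unset Primitive Projections.

Arguments fib {n} b {m}.
Arguments tr {n} b {l m f}.

Section Total.
Variables (n : nat) (B : bundle n).

Program Definition total : sset :=
  @SSet (fun m => {f : hom m n & fib B f})
    (fun l m g t => existT _ (comph (projT1 t) g) (tr B g (projT2 t))) _ _.
Next Obligation. by rewrite tr_id. Qed.
Next Obligation. by rewrite tr_comp. Qed.

Definition total_proj : smap total (Delta n) :=
  @SMap total (Delta n) (fun m t => projT1 t) (fun _ _ _ _ => erefl).
End Total.

Definition bundle_restr m n (f : hom m n) (B : bundle n) : bundle m :=
  @Bundle m (fun l g => fib B (comph f g))
    (fun k l g h s => tr B h s)
    (fun l g s => tr_id s)
    (fun j k l g h h' s => tr_comp h h' s).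

Definition Bundles : sset :=
  @SSet bundle bundle_restr (fun _ _ => erefl) (fun _ _ _ _ _ _ => erefl).

Program Definition total_restr m n (f : hom m n) (B : bundle n) :
    smap (total (bundle_restr f B)) (total B) :=
  @SMap (total (bundle_restr f B)) (total B)
    (fun l t => existT _ (comph f (projT1 t)) (projT2 t)) _.

Lemma total_restr_inj m n (f : hom m n) (B : bundle n) l
    (s t : total (bundle_restr f B) l) :
  projT1 s = projT1 t ->
  total_restr f B l s = total_restr f B l t -> s = t.
Proof.
case: s t => g s [g' t] /= e; subst g' => e.
by rewrite (inj_pairT2 _ _ _ _ _ e).
Qed.

Lemma total_restr_surj m n (f : hom m n) (B : bundle n) l
    (g : hom l m) (t : total B l) :
  projT1 t = comph f g ->
  {s : total (bundle_restr f B) l | projT1 s = g /\ total_restr f B l s = t}.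
Proof.
case: t => h t /= e; subst h.
by exists (existT (fun g => fib B (comph f g)) g t).
Qed.

Lemma left_fibration_restr m n (f : hom m n) (B : bundle n) :
  left_fibration (total_proj B) ->
  left_fibration (total_proj (bundle_restr f B)).
Proof.
move=> hB k i hi u v e.
have e1 l x : projT1 (u l x) = v l (proj1_sig x).
  exact: (f_equal (fun q : smap _ _ => q l x) e).
have [|w [wu wv]] := hB k i hi (scomp (total_restr f B) u)
    (scomp (DeltaMap f) v).
  by apply: smap_eq => l x /=; rewrite e1.
have w1 l x : projT1 (w l x) = comph f (v l x).
  exact: (f_equal (fun q : smap _ _ => q l x) wv).
have [s [s1 s2]] : {s : forall l, Delta k l -> total (bundle_restr f B) l |
    (forall l x, projT1 (s l x) = v l x) /\
    (forall l x, total_restr f B l (s l x) = w l x)}.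
  exists (fun l x => proj1_sig (total_restr_surj (w1 l x))).
  by split=> l x; case: total_restr_surj => t [].
have snat j l (g : hom j l) x : s j (act g x) = act g (s l x).
  apply: total_restr_inj; first by rewrite s1 app_nat /= s1.
  by rewrite s2 !app_nat s2.
exists (@SMap (Delta k) (total (bundle_restr f B))
  s snat); split; apply: smap_eq => l x /=.
- apply: total_restr_inj; first by rewrite s1 e1.
  by rewrite s2; exact: (f_equal (fun q : smap _ _ => q l x) wu).
- exact: s1.
Qed.

(* An n-simplex is a left fibration over Delta n with small fibres, presented
   as a presheaf on the simplices of Delta n so that pulling back along maps
   Delta m -> Delta n is strictly functorial (Cisinski's model of the
   infinity-category of spaces). *)
Definition Spaces : sset :=
  @ssub Bundles (fun n (B : bundle n) => left_fibration (total_proj B))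
    left_fibration_restr.

Program Definition PointedBundles : sset :=
  @SSet (fun n => {B : bundle n & fib B (idh n)})
    (fun m n f t =>
       existT _ (bundle_restr f (projT1 t)) (tr (projT1 t) f (projT2 t))) _ _.
Next Obligation. by rewrite tr_id. Qed.
Next Obligation. by rewrite tr_comp. Qed.

(* The left fibration over A classified by F : A -> Spaces: the pullback along
   F of the universal left fibration of pointed spaces. *)
Program Definition Elements (A : sset) (F : smap A Spaces) : sset :=
  @ssub (Prod A PointedBundles)
    (fun n (t : A n * {B : bundle n & fib B (idh n)}) =>
       proj1_sig (F n t.1) = projT1 t.2) _.
Next Obligation. by rewrite app_nat. Qed.

Definition card_lt (A B : Type) : Prop :=
  (exists f : A -> B, injective f) /\ ~ (exists g : B -> A, injective g).

(* Infinite regular cardinals, represented by small types. *)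
Definition regular (kappa : SmallType) : Prop :=
  (exists f : nat -> kappa, injective f) /\
  forall (I : SmallType) (T : I -> SmallType),
    card_lt I kappa -> (forall i, card_lt (T i) kappa) ->
    card_lt {i : I & T i} kappa.

Definition nondegenerate (X : sset) n (x : X n) : Prop :=
  forall m (s : hom n m) (y : X m), m < n -> x <> act s y.

Definition cardinal_small (kappa : Type) (X : sset) : Prop :=
  card_lt {n : nat & {x : X n | nondegenerate x}} kappa.

Definition filtered (kappa : Type) (X : sset) : Prop :=
  forall K : sset, cardinal_small kappa K -> forall u : smap K X,
  exists v : smap (join K (Delta 0)) X, scomp v (join_inl K (Delta 0)) = u.

Definition Presheaves (A : sset) : sset := Fun (op A) Spaces.

(* The functor X -> Y underlying an object of Fun X Y. *)
Program Definition functor_of X Y (F : Fun X Y 0) : smap X Y :=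
  @SMap X Y (fun n x => F n (consth n ord0, x)) _.
Next Obligation. by rewrite -app_nat. Qed.

(* The presheaves on A whose associated right fibration over A has
   kappa-filtered total space; that right fibration is the opposite of the left
   fibration over op A classified by the presheaf. *)
Definition ind_object (kappa : Type) (A : sset) (F : Presheaves A 0) : Prop :=
  filtered kappa (op (Elements (functor_of F))).

Definition ind_simplex (kappa : Type) (A : sset) n (F : Presheaves A n) :
  Prop := forall v : hom 0 n, ind_object kappa (act v F).

Lemma ind_simplex_act (kappa : Type) (A : sset) m n (f : hom m n)
    (F : Presheaves A n) :
  ind_simplex kappa F -> ind_simplex kappa (act f F).
Proof. by move=> h v; rewrite -act_comp; exact: h. Qed.

Definition Ind (kappa : Type) (A : sset) : sset :=
  @ssub (Presheaves A) (@ind_simplex kappa A) (@ind_simplex_act kappa A).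

Definition accessible (X : sset) : Prop :=
  exists2 kappa : SmallType, regular kappa &
  exists A : sset, [/\ quasicat A, small A & cat_equiv (Ind kappa A) X].

Definition presentable (X : sset) : Prop :=
  [/\ quasicat X, accessible X & has_small_colimits X].

Program Definition Tw (A : sset) : sset :=
  @SSet (fun n => A (eps n)) (fun m n f x => act (epsh f) x) _ _.
Next Obligation. by rewrite epsh_id act_id. Qed.
Next Obligation. by rewrite epsh_comp act_comp. Qed.

Program Definition SigmaTw (A : sset) : smap (Tw A) (Prod (op A) A) :=
  @SMap (Tw A) (Prod (op A) A)
    (fun n x => (act (tailh n) x, act (headh n) x)) _.
Next Obligation.
by congr pair; rewrite -!act_comp ?epsh_tail ?epsh_head.
Qed.

Definition coend (A X : sset) (colim : smap (Fun (Tw A) X) X) :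
    smap (Fun (Prod (op A) A) X) X :=
  scomp colim (precomp (SigmaTw A) X).

Definition swap X Y : smap (Prod X Y) (Prod Y X) := spair (ssnd X Y) (sfst X Y).

Definition Quad (C E : sset) : sset := Prod (Prod (op C) C) (Prod (op E) E).

Program Definition shuffle (C E : sset) :
    smap (Prod (op (Prod C E)) (Prod C E))
         (Quad C E) :=
  @SMap (Prod (op (Prod C E)) (Prod C E)) (Quad C E)
    (fun n t => ((t.1.1, t.2.1), (t.1.2, t.2.2))) _.

Section DoubleCoends.
Variables C E D : sset.
Variable colimC : smap (Fun (Tw C) D) D.
Variable colimE : smap (Fun (Tw E) D) D.
Variable colimCE : smap (Fun (Tw (Prod C E)) D) D.

Definition iint_CE : smap (Fun (Quad C E) D) D :=
  scomp (coend colimC)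
    (scomp (postcomp (Prod (op C) C) (coend colimE))
      (curry (Prod (op C) C) (Prod (op E) E) D)).

Definition iint_EC : smap (Fun (Quad C E) D) D :=
  scomp (coend colimE)
    (scomp (postcomp (Prod (op E) E) (coend colimC))
      (scomp (curry (Prod (op E) E) (Prod (op C) C) D)
        (precomp (swap (Prod (op E) E) (Prod (op C) C)) D))).

Definition int_pair : smap (Fun (Quad C E) D) D :=
  scomp (coend colimCE) (precomp (shuffle C E) D).
End DoubleCoends.

(* A natural isomorphism between functors on Fun X D, together with the
   isomorphisms between their values of which it consists. *)
Definition naturally_isomorphic (X D : sset) (S T : smap (Fun X D) D) : Prop :=
  exists e : Fun (Fun X D) D 1,
    is_equiv (vert S) (vert T) e /\
    forall F : smap X D,
      is_equiv (S 0 (vert F)) (T 0 (vert F)) (component e (vert F)).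

(* Main.v *)
From mathcomp Require Import all_boot zify.
From mathcomp Require Import boolp.
From mathcomp Require classical_sets.
Require Import Defs.

Set Implicit Arguments.
Unset Strict Implicit.
Unset Printing Implicit Defensive.

(* Evaluation followed by Sigma_C x Sigma_E gives a functor
   a : Fun(Quad C E, D) x Tw C x Tw E -> D.  Up to strict isomorphism, all
   three coend functors l are computed by colimits of a along Tw C x Tw E, so
   each comes with an edge a -> l p, p the projection to Fun(Quad C E, D),
   which is universal up to homotopy among edges from a to functors of the
   form b p.  For the iterated coends this holds because universal edges along
   two successive projections compose; note that Tw (C x E) = Tw C x Tw E on
   the nose.  Functors with universal edges out of the same a are equivalent.

   This is an argument in the homotopy categories of Fun(W, D), so it needs
   Fun(W, D) to be a quasi-category.  A map to D from the union of
   horn(2, 1) x Delta m and Delta 2 x (boundary of Delta m) extends to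
   Delta 2 x Delta m by filling inner horns: a chain in the grid [2] x [m]
   missing from this union is paired with the chain that contains in addition
   (1, p), where (0, p) is its last vertex in row 0.  Skeletal induction
   replaces the boundary inclusion by any inclusion, and every inner horn is a
   retract of such a union. *)

(** * Partial maps and cell attachment *)

(** A relation needs no subtype for the domain of a partial map, and inclusion of relations is the
    order used for Zorn's lemma. *)
Definition graph (X Y : sset) := forall n, X n -> Y n -> Prop.

Definition subgraph X Y (R S : graph X Y) := forall n x y, R n x y -> S n x y.

Definition defined X Y (R : graph X Y) n (x : X n) := exists y, R n x y.

Record partial_map X Y (R : graph X Y) : Prop := PartialMap {
  pm_act : forall m n (f : hom m n) x y, R n x y -> R m (act f x) (act f y);
  pm_fun : forall n x y y', R n x y -> R n x y' -> y = y' }.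

Definition sieve (X : sset) (K : forall n, X n -> Prop) :=
  forall m n (f : hom m n) (x : X n), K n x -> K m (act f x).

(* Maps out of the subobject K of Y are encoded as partial maps on Y. *)
Definition extends_along (Y : sset) (K : forall n, Y n -> Prop) (X : sset) :=
  forall R : graph Y X, partial_map R -> (forall n y, K n y -> defined R y) ->
  exists w : smap Y X, forall n y, K n y -> R n y (w n y).

Lemma defined_act X Y (R : graph X Y) m n (f : hom m n) x :
  partial_map R -> defined R x -> defined R (act f x).
Proof. by move=> hR [y h]; exists (act f y); exact: pm_act. Qed.

Definition union X Y (F : graph X Y -> Prop) : graph X Y :=
  fun n x y => exists2 R, F R & R n x y.

Definition chain X Y (F : graph X Y -> Prop) :=
  forall R S, F R -> F S -> subgraph R S \/ subgraph S R.

Lemma union_partial_map X Y (F : graph X Y -> Prop) :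
  (forall R, F R -> partial_map R) -> chain F -> partial_map (union F).
Proof.
move=> hF hc; split=> [m n f x y [R FR h]|n x y y' [R FR h] [S FS h']].
  by exists R => //; apply: pm_act => //; exact: hF.
have [/(_ _ _ _ h)|/(_ _ _ _ h')] := hc R S FR FS => h''.
  exact: (pm_fun (hF S FS) h'').
exact: (pm_fun (hF R FR) h).
Qed.

(** Zorn's lemma. Closure under unions is asked for nonempty chains only, since [R0] bounds the
    empty one. *)
Lemma maximal_graph X Y (P : graph X Y -> Prop) R0 :
  P R0 ->
  (forall F, (exists R, F R) -> (forall R, F R -> P R) -> chain F ->
     P (union F)) ->
  exists2 R, P R & forall S, P S -> subgraph R S -> subgraph S R.
Proof.
move=> P0 PU; pose T := {R : graph X Y | P R}.
pose leT (R S : T) := `[< subgraph (sval R) (sval S) >].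
have [|R S U /asboolP h /asboolP h'|A hA|R hR] :=
  @classical_sets.ZL_preorder T (exist _ R0 P0) leT.
- by move=> R; apply/asboolP.
- by apply/asboolP => n x y /h /h'.
- have [[R AR]|nA] := pselect (exists R, A R); last first.
    by exists (exist _ R0 P0) => R AR; case: nA; exists R.
  pose F (R : graph X Y) := exists2 S : T, A S & sval S = R.
  have PF : P (union F).
    apply: PU => [|S|S S']; first by exists (sval R), R.
      by case=> -[S' h] _ /= <-.
    move=> [U AU <-] [U' AU' <-].
    by have [/asboolP|/asboolP] := hA U U' AU AU'; [left|right].
  exists (exist _ _ PF) => S AS; apply/asboolP => n x y h.
  by exists (sval S) => //; exists S.
- exists (sval R) => [|S PS h]; first exact: (svalP R).
  by apply/asboolP; apply: (hR (exist _ S PS)); apply/asboolP.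
Qed.

Definition image_graph X Y Z (z : smap Z X) (w : smap Z Y) : graph X Y :=
  fun n x y => exists2 t, x = z n t & y = w n t.

Definition join_graph X Y (R S : graph X Y) : graph X Y :=
  fun n x y => R n x y \/ S n x y.

(* K is the part of Z already covered by R; away from K the map z is injective
   and avoids the domain of R. *)
Lemma attach X Y Z (z : smap Z X) (K : forall n, Z n -> Prop) (R : graph X Y) :
  partial_map R -> extends_along K Y ->
  (forall n t, K n t <-> defined R (z n t)) ->
  (forall n t t', ~ K n t -> ~ K n t' -> z n t = z n t' -> t = t') ->
  exists w : smap Z Y, partial_map (join_graph R (image_graph z w)).
Proof.
move=> hR hK hd hi.
have [||w hw] := hK (fun n t y => R n (z n t) y).
- split=> [m n f t y h|n t y y']; last exact: pm_fun.
  by rewrite app_nat; exact: pm_act.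
- by move=> n t /hd.
exists w; split=> [m n f x y [h|[t -> ->]]|n x y y'].
- by left; exact: pm_act.
- by right; exists (act f t); rewrite app_nat.
(* Where [z n t] is already in the domain of [R], the new value agrees with the old one. *)
have key t u : R n (z n t) u -> u = w n t.
  by move=> h; apply: (pm_fun hR h); apply: hw; apply/hd; exists u.
move=> [h|[t -> ->]] [h'|[t' e' ->]].
- exact: (pm_fun hR h).
- by subst x; exact: key.
- by rewrite (key t y').
- have [kt|kt] := pselect (K n t).
    by apply: key; rewrite -e'; exact: hw.
  congr (w n _); apply: hi => // kt'; apply: kt; apply/hd; rewrite e'; exact/hd.
Qed.

Lemma total_graph X Y (R : graph X Y) :
  partial_map R -> (forall n (x : X n), defined R x) ->
  exists w : smap X Y, forall n x, R n x (w n x).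
Proof.
move=> hR ht; pose w n x := sval (cid (ht n x)).
have wP n x : R n x (w n x) by rewrite /w; case: cid.
have wn m n (f : hom m n) x : w m (act f x) = act f (w n x).
  by apply: (pm_fun hR (wP _ _)); exact: pm_act.
by exists (SMap wn).
Qed.

Lemma restrict_partial_map X Y (R : graph X Y) (K : forall n, X n -> Prop) :
  sieve K -> partial_map R -> partial_map (fun n x y => K n x /\ R n x y).
Proof.
move=> sK hR; split=> [m n f x y [k h]|n x y y' [_ h] [_ h']].
  by split; [exact: sK|exact: pm_act].
exact: (pm_fun hR h).
Qed.

(** * Horns, faces and degeneracies of simplices *)

Program Definition yon (X : sset) n (x : X n) : smap (Delta n) X :=
  @SMap (Delta n) X (fun m f => act f x) _.
Next Obligation. exact: act_comp. Qed.

Definition misses m n (f : hom m n) j := forall i, f i != j.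

Definition in_horn n (k : 'I_n.+1) m (f : hom m n) :=
  exists2 j, j != k & misses f j.

Definition in_boundary n m (f : hom m n) := exists j, misses f j.

Lemma sieve_horn n (k : 'I_n.+1) : @sieve (Delta n) (@in_horn n k).
Proof. by move=> l m g f [j jk h]; exists j => // i; exact: h. Qed.

Lemma sieve_boundary n : @sieve (Delta n) (@in_boundary n).
Proof. by move=> l m g f [j h]; exists j => i; exact: h. Qed.

(** Functionality of [R] makes the chosen values natural, so they form a map out of the subtype
    [horn k]. *)
Lemma quasicat_extends X n (k : 'I_n.+1) :
  quasicat X -> 0 < k < n -> @extends_along (Delta n) (@in_horn n k) X.
Proof.
move=> hX hk R hR hd.
have hu l (f : horn k l) : exists y, R l (sval f) y.
  by case: f => f [j jk h]; apply: hd; exists j.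
pose u l f := sval (cid (hu l f)).
have uP l f : R l (sval f) (u l f) by rewrite /u; case: cid.
have un l m (g : hom l m) (f : horn k m) : u l (act g f) = act g (u m f).
  by apply: (pm_fun hR (uP _ _)); apply: (pm_act hR g (uP _ f)).
have [w hw] := hX n k hk (SMap un).
exists w => m f hf.
pose x : horn k m := exist _ f hf.
suff -> : w m f = u m x by exact: (uP m x).
exact: (f_equal (fun q : smap (horn k) X => q m x) hw).
Qed.

Lemma face_inj n (i : 'I_n.+2) m (f g : hom m n) :
  comph (face i) f = comph (face i) g -> f = g.
Proof.
move=> e; apply: hom_eq => a; apply: (@lift_inj _ i).
exact: (f_equal (fun h : hom _ _ => h a) e).
Qed.

Lemma misses_face n m (f : hom m n.+1) j :
  misses f j -> exists g : hom m n, f = comph (face j) g.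
Proof.
move=> h; pose g i := odflt ord0 (unlift j (f i)).
have gE i : lift j (g i) = f i.
  by rewrite /g; case: unliftP (h i) => [a ->|->] //; rewrite eqxx.
have gm (a b : 'I_m.+1) : a <= b -> g a <= g b.
  by move=> ab; rewrite -(leq_bump2 j); move: (hmono f ab); rewrite -!gE.
by exists (Hom gm); apply: hom_eq => i; rewrite -[LHS]gE.
Qed.

Lemma not_misses m n (f : hom m n) j : ~ misses f j -> exists i, f i = j.
Proof.
move=> h; apply: contrapT => h'; apply: h => i; apply/eqP => e.
by apply: h'; exists i.
Qed.

Lemma hom_lt m n (f : hom m n) i j : f i < f j -> i < j.
Proof. by rewrite !ltnNge; apply: contraNN; exact: hmono. Qed.

(** Any choice of preimages is monotone because [f] reflects [<], so the preimage of [f i0] may be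
    prescribed. *)
Lemma surjective_section m n (f : hom m n) i0 :
  ~ in_boundary f -> exists s : hom n m, comph f s = idh n /\ s (f i0) = i0.
Proof.
move=> hf; have fs j : exists i, f i = j.
  by apply: not_misses => h; apply: hf; exists j.
pose s j := if j == f i0 then i0 else sval (cid (fs j)).
have fsK j : f (s j) = j.
  by rewrite /s; case: eqP => [->|_] //; case: cid.
have sm (a b : 'I_n.+1) : a <= b -> s a <= s b.
  rewrite leq_eqVlt => /orP[/eqP /val_inj -> //|ab].
  by apply: ltnW; apply: (@hom_lt _ _ f); rewrite !fsK.
exists (Hom sm); split; first exact: hom_eq.
by rewrite /= /s eqxx.
Qed.

(** Strict monotonicity gives [i <= f i]; the same bound for [revh f] is the reverse inequality. *)
Lemma increasing_id n (f : hom n n) :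
  (forall i j : 'I_n.+1, i < j -> f i < f j) -> f = idh n.
Proof.
have ge (g : hom n n) : (forall i j : 'I_n.+1, i < j -> g i < g j) ->
    forall i : 'I_n.+1, i <= g i.
  move=> gm [i]; elim: i => [//|i IH] hi.
  have hi' : i < n.+1 by apply: ltnW.
  exact: leq_ltn_trans (IH hi') (gm (Ordinal hi') (Ordinal hi) (leqnn _)).
move=> fm; apply: hom_eq => i; apply/val_inj/eqP; rewrite eqn_leq ge // andbT.
have : rev_ord i <= revh f (rev_ord i).
  apply: ge => a b ab /=; have := fm (rev_ord b) (rev_ord a).
  by move: (ltn_ord (f (rev_ord a))) (ltn_ord b) => /=; lia.
by rewrite /= rev_ordK; move: (ltn_ord i) (ltn_ord (f i)) => /=; lia.
Qed.

(** A section of [f] is strictly increasing, hence the identity. *)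
Lemma surjective_id n (f : hom n n) : ~ in_boundary f -> f = idh n.
Proof.
move=> hf; have [s [fs _]] := surjective_section ord0 hf.
have fsK j : f (s j) = j by exact: (f_equal (fun h : hom _ _ => h j) fs).
have sid : s = idh n.
  by apply: increasing_id => i j ij; apply: (@hom_lt _ _ f); rewrite !fsK.
by move: fs; rewrite sid.
Qed.

(* Eilenberg-Zilber: the faces of x lie in S but x does not, so x is
   nondegenerate and determines the degeneracy f in f^* x. *)
Lemma degeneracy_unique (X : sset) (S : forall n, X n -> Prop) n (x : X n)
    m (f g : hom m n) :
  sieve S -> ~ S n x ->
  (forall l (h : hom l n), in_boundary h -> S l (act h x)) ->
  ~ in_boundary f -> ~ in_boundary g -> act f x = act g x -> f = g.
Proof.
move=> sS nx hx hf hg e; apply: hom_eq => i.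
(* With a section [s] of [f] through [i], the map [comph g s] is the identity: otherwise it would be
   in the boundary and put [x] in [S]. Its value at [f i] then gives [g i = f i]. *)
have [s [fs si]] := surjective_section i hf.
have gs : comph g s = idh n.
  apply: surjective_id => /hx; rewrite act_comp -e -act_comp fs act_id.
  exact: nx.
by have := f_equal (fun h : hom _ _ => h (f i)) gs; rewrite /= si.
Qed.

(** * From boundary inclusions to arbitrary inclusions *)

Definition mid : 'I_3 := lift ord0 ord0.

(** The domain of the pushout-product of the inner horn inclusion into [Delta 2] with the inclusion
    of [A] into [B]. *)
Definition corner (B : sset) (A : forall n, B n -> Prop) n
    (t : Prod (Delta 2) B n) : Prop :=
  in_horn mid t.1 \/ A n t.2.

Lemma sieve_corner (B : sset) (A : forall n, B n -> Prop) :
  sieve A -> sieve (corner A).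
Proof.
move=> sA m n f t [h|h]; [left|right; exact: sA].
exact: (@sieve_horn 2 mid _ _ f _ h).
Qed.

Lemma corner_extends (B X : sset) (A : forall n, B n -> Prop) :
  sieve A ->
  (forall m, @extends_along (Prod (Delta 2) (Delta m))
     (@corner (Delta m) (@in_boundary m)) X) ->
  extends_along (corner A) X.
Proof.
move=> sA hX R hR hd.
pose R0 : graph (Prod (Delta 2) B) X := fun n t y => corner A t /\ R n t y.
(* [S U] holds the simplices whose whole prism with [Delta 2] is in the domain of [U]. The last
   clause of [P] keeps the domain within the horn part and such prisms. *)
pose S (U : graph (Prod (Delta 2) B) X) n (b : B n) :=
  forall m (f : hom m n) (c : hom m 2), @defined _ _ U m (c, act f b).
pose P U := [/\ partial_map U, subgraph R0 U & forall n t, @defined _ _ U n t ->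
  in_horn mid t.1 \/ S U n t.2].
have sS U : sieve (S U).
  by move=> m n f b h l g c; rewrite -act_comp.
have SU U U' n b : subgraph U U' -> S U n b -> S U' n b.
  by move=> h s m f c; have [y /h] := s m f c; exists y.
have [||U [hU hU0 hUS] Umax] := @maximal_graph _ _ P R0.
- split=> //; first by apply: restrict_partial_map => //; exact: sieve_corner.
  move=> n t [y [[h|h] _]]; [by left|right=> m f c].
  have k : corner A ((c, act f t.2) : Prod (Delta 2) B m) by right; exact: sA.
  by have [z hz] := hd m _ k; exists z.
- move=> F [V FV] PF cF; split.
  + by apply: union_partial_map => // W /PF [].
  + by move=> n t y h; exists V => //; have [_ + _] := PF V FV; apply.
  + move=> n t [y [W FW h]]; have [_ _ hW] := PF W FW.
    have [|h'|s] := hW n t; first by exists y.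
      by left.
    by right; apply: SU s => k u v ?; exists W.
have hSt n b : S U n b.
  (* A simplex of least dimension outside [S U] has its faces in [S U]; attaching its prism along
     the corner contradicts maximality. *)
  elim/ltn_ind: n b => n IH b; apply: contrapT => nb.
  have face_S l (h : hom l n) : in_boundary h -> S U l (act h b).
    move=> [j hj]; case: n b nb IH h j hj => [|n] b _ IH h j hj.
      by have := hj ord0; rewrite (ord1 j) (ord1 (h ord0)).
    have [g ->] := misses_face hj; rewrite act_comp; apply: sS; exact: IH.
  pose z : smap (Prod (Delta 2) (Delta n)) (Prod (Delta 2) B) :=
    sprod (sid (Delta 2)) (yon b).
  have zd m t : @corner (Delta n) (@in_boundary n) m t <-> defined U (z m t).
    split=> [[h|h]|/hUS [h|h]].
    - have k : corner A (z m t) by left.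
      have [y hy] := hd _ _ k; exists y; exact: hU0.
    - have := face_S _ _ h _ (idh m) t.1.
      by rewrite act_id.
    - by left.
    (* If [t.2] were surjective, a section would recover [b] from a simplex of [S U]. *)
    - right; apply: contrapT => ht.
      have [s [ts _]] := surjective_section ord0 ht.
      by apply: nb; rewrite -(act_id b) -ts act_comp; exact: sS.
  have zi m t t' : ~ @corner (Delta n) (@in_boundary n) m t ->
      ~ @corner (Delta n) (@in_boundary n) m t' -> z m t = z m t' -> t = t'.
    case: t t' => c f [c' f'] h h' /= [<- e]; congr pair.
    apply: (degeneracy_unique (sS U) nb face_S _ _ e) => k;
      [apply: h|apply: h'].
      by right.
    by right.
  have [w hw] := attach hU (hX n) zd zi.
  set U' := join_graph _ _ in hw.
  have UU' : subgraph U U' by move=> *; left.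
  have zS : S U' n b.
    by move=> m f c; exists (w m (c, f)); right; exists (c, f).
  apply: nb; apply: (SU _ _ _ _ _ zS); apply: (Umax U') => //.
  split=> //; first by move=> k t y /hU0 /UU'.
  move=> k t [y [h|[[c f] -> _]]].
    have [|h'|h'] := hUS k t; first by exists y.
      by left.
    by right; exact: SU h'.
  by right; exact: (sS U' _ _ f b zS).
have [|w hw] := total_graph hU.
  by move=> n [c b]; have := hSt n b n (idh n) c; rewrite act_id.
exists w => n t k; have [y hy] := hd n t k.
by rewrite (pm_fun hU (hw n t) (hU0 _ _ _ (conj k hy))).
Qed.

(** * The corner of an inner horn and a boundary *)

Section Grid.
Variable m : nat.
Implicit Types (k l : nat) (p q : 'I_m.+1).

Local Notation grid := (Prod (Delta 2) (Delta m)).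
Local Notation missing t := (~ @corner (Delta m) (@in_boundary m) _ t).

(** Simplices are weakly increasing chains in the poset [2] x [m]: the first coordinate is the row,
    the second the column. *)
Definition vtx k (t : grid k) i : 'I_3 * 'I_m.+1 := (t.1 i, t.2 i).

Definition vertex_of k (t : grid k) v := exists i, vtx t i = v.

Definition tip k (t : grid k) p :=
  vertex_of t (ord0, p) /\ forall q, vertex_of t (ord0, q) -> q <= p.

Definition le_grid (u v : 'I_3 * 'I_m.+1) := (u.1 <= v.1) && (u.2 <= v.2).

Lemma vtx_le k (t : grid k) (i j : 'I_k.+1) :
  i <= j -> le_grid (vtx t i) (vtx t j).
Proof. by move=> h; rewrite /le_grid !hmono. Qed.

Lemma le_grid_trans : transitive le_grid.
Proof.
move=> v u w /andP[a b] /andP[c d].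
by rewrite /le_grid (leq_trans a c) (leq_trans b d).
Qed.

Lemma le_grid_refl : reflexive le_grid.
Proof. by move=> u; rewrite /le_grid !leqnn. Qed.

Lemma le_grid_anti u v : le_grid u v -> le_grid v u -> u = v.
Proof.
case: u v => a b [c d] /andP[/= ac bd] /andP[/= ca db].
by congr pair; apply/val_inj/eqP; rewrite eqn_leq ?ac ?bd.
Qed.

Lemma grid_eq k (s t : grid k) : (forall i, vtx s i = vtx t i) -> s = t.
Proof.
case: s t => a b [c d] e; congr pair; apply: hom_eq => i.
  by case: (e i).
by case: (e i).
Qed.

(** The horn on [mid] consists of the simplices that miss row 0 or row 2, so row 1 imposes no
    condition. *)
Lemma missingP k (t : grid k) :
  missing t <-> [/\ exists p, vertex_of t (ord0, p),
                    exists p, vertex_of t (ord_max, p)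
                  & forall p, exists a, vertex_of t (a, p)].
Proof.
split=> [h|[[p [i ei]] [q [j ej]] hb] [[a ha hm]|[b hb']]].
- split=> [||p].
  + have [|i e] := @not_misses _ _ t.1 ord0.
      by move=> h'; apply: h; left; exists ord0.
    by exists (t.2 i), i; rewrite /vtx e.
  + have [|i e] := @not_misses _ _ t.1 ord_max.
      by move=> h'; apply: h; left; exists ord_max.
    by exists (t.2 i), i; rewrite /vtx e.
  + have [|i e] := @not_misses _ _ t.2 p.
      by move=> h'; apply: h; right; exists p.
    by exists (t.1 i), i; rewrite /vtx e.
- case: ei ej => ei _ [ej _].
  have := hm i; have := hm j; rewrite ei ej; move: ha.
  by case: a {hm} => [[|[|[|a]]] ?].
- have [a [i' [_ e]]] := hb b.
  by have := hb' i'; rewrite e eqxx.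
Qed.

Lemma tip_exists k (t : grid k) : missing t -> exists p, tip t p.
Proof.
move=> /missingP [[p0 h0] _ _].
pose Q p := `[< vertex_of t (ord0, p) >].
have Q0 : Q p0 by apply/asboolP.
case: (@arg_maxnP _ p0 Q (fun p => p) Q0) => p /asboolP hp hmax.
by exists p; split=> // q hq; apply: hmax; apply/asboolP.
Qed.

Definition nondeg k (t : grid k) := injective (vtx t).

(** A simplex of the nerve of a poset is determined by its vertices; antisymmetry makes the
    positions in [s] of the vertices of [t] monotone. *)
Lemma nondeg_factor k l (s : grid k) (t : grid l) :
  nondeg s -> (forall v, vertex_of t v -> vertex_of s v) ->
  exists f : hom l k, t = act f s.
Proof.
move=> hs h; have hi i : vertex_of s (vtx t i) by apply: h; exists i.
pose f i := sval (cid (hi i)).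
have fE i : vtx s (f i) = vtx t i by rewrite /f; case: cid.
have fm (i j : 'I_l.+1) : i <= j -> f i <= f j.
  move=> ij; case: (leqP (f i) (f j)) => // ji.
  have e : f i = f j.
    apply: hs; rewrite !fE; apply: le_grid_anti; first exact: vtx_le.
    by rewrite -!fE; apply: vtx_le; exact: ltnW.
  by move: ji; rewrite e ltnn.
by exists (Hom fm); apply: grid_eq => i; rewrite -fE.
Qed.

Lemma enumerate_chain (A : seq ('I_3 * 'I_m.+1)) :
  (0 < size A) -> {in A &, ssrbool.total le_grid} ->
  exists k (s : grid k), nondeg s /\ forall v, vertex_of s v <-> v \in A.
Proof.
move=> A0 tA; pose s := sort le_grid (undup A).
have memS v : (v \in s) = (v \in A) by rewrite mem_sort mem_undup.
have [k sk] : exists k, size s = k.+1.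
  exists (size s).-1; rewrite prednK // lt0n size_eq0; apply/eqP => e.
  move: memS; rewrite e; case: (A) A0 => // a A' _ /(_ a).
  by rewrite !inE eqxx.
have ss : sorted le_grid s.
  apply: (@sort_sorted_in _ (mem A)) => //.
  by apply/allP => v; rewrite mem_undup.
have us : uniq s by rewrite sort_uniq undup_uniq.
pose v0 : 'I_3 * 'I_m.+1 := (ord0, ord0).
pose g (i : 'I_k.+1) := nth v0 s i.
have gm (i j : 'I_k.+1) : i <= j -> le_grid (g i) (g j).
  move=> ij; apply: (sorted_leq_nth le_grid_trans le_grid_refl) => //;
  by rewrite inE sk.
have g1 (i j : 'I_k.+1) : i <= j -> (g i).1 <= (g j).1 by case/gm/andP.
have g2 (i j : 'I_k.+1) : i <= j -> (g i).2 <= (g j).2 by case/gm/andP.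
have gE i : vtx ((Hom g1, Hom g2) : grid k) i = g i.
  by rewrite /vtx /=; case: (g i).
exists k, (Hom g1, Hom g2); split=> [i j|v].
  rewrite !gE => /eqP; rewrite nth_uniq ?sk // => /eqP; exact: val_inj.
rewrite -memS; split=> [[i <-]|vs].
  by rewrite gE mem_nth // sk.
have vk : index v s < k.+1 by rewrite -sk index_mem.
by exists (Ordinal vk); rewrite gE /g /= nth_index.
Qed.

(* The parent of t is t with the vertex (1, p) inserted right after its last
   vertex (0, p) in row 0. *)
Definition parent k (t : grid k) l (s : grid l) p :=
  forall v, vertex_of s v <-> vertex_of t v \/ v = (mid, p).

(** The vertex [(mid, p)] is comparable to all others: those in row 0 have column at most [p], and
    those in later rows come after [(ord0, p)], so have column at least [p]. *)
Lemma parent_exists k (t : grid k) p : tip t p ->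
  exists l (s : grid l), nondeg s /\ parent t s p.
Proof.
move=> [[i0 e0] hp].
pose A := (mid, p) :: [seq vtx t i | i <- enum 'I_k.+1].
have memA v : v \in A <-> vertex_of t v \/ v = (mid, p).
  rewrite inE; split=> [/orP[/eqP ->|/mapP[i _ ->]]|[[i <-]| ->]].
  - by right.
  - by left; exists i.
  - by rewrite map_f ?orbT // mem_enum.
  - by rewrite eqxx.
have cmp i : le_grid (vtx t i) (mid, p) || le_grid (mid, p) (vtx t i).
  case: (posnP (t.1 i)) => ti.
    have e : t.1 i = ord0 by apply: val_inj.
    have : t.2 i <= p by apply: hp; exists i; rewrite /vtx e.
    by rewrite /le_grid /= ti => ->.
  rewrite /le_grid /= /bump /= addn0 ti /=; apply/orP; right.
  have : i0 <= i.
    rewrite leqNgt; apply/negP => /ltnW /(hmono t.1); case: e0 => -> _ /=.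
    by rewrite leqNgt ti.
  by move=> /(hmono t.2); case: e0 => _ ->.
have tA : {in A &, ssrbool.total le_grid}.
  move=> u v /memA [[i <-]| ->] /memA [[j <-]| ->] //.
  - by case/orP: (leq_total i j) => /vtx_le ->; rewrite ?orbT.
  - by rewrite orbC.
  - by rewrite le_grid_refl.
have [l [s [ns hs]]] := enumerate_chain (isT : 0 < size A) tA.
by exists l, s; split=> // v; split=> [/hs/memA|/memA/hs].
Qed.

Lemma vertex_act k l (f : hom l k) (t : grid k) v :
  @vertex_of l (act f t) v -> vertex_of t v.
Proof. by move=> [i <-]; exists (f i). Qed.

Lemma nondeg_dim k l (s : grid k) (f : hom l k) j :
  misses f j -> nondeg (act f s : grid l) -> l < k.
Proof.
move=> fj ns; case: k s f j fj ns => [|k] s f j fj ns.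
  by have := fj ord0; rewrite (ord1 j) (ord1 (f ord0)).
have [g e] := misses_face fj.
have gi : injective g.
  by move=> a b ab; apply: ns; rewrite /vtx /= e /= ab.
by have := leq_card g gi; rewrite !card_ord.
Qed.

(** A maximal extension closed under passage to parents contains every nondegenerate parent, since
    otherwise an inner horn at [(mid, p)] could be filled. *)
Lemma grid_corner_extends X :
  quasicat X ->
  @extends_along grid (@corner (Delta m) (@in_boundary m)) X.
Proof.
move=> hX R hR hd.
pose R0 : graph grid X :=
  fun n t y => @corner (Delta m) (@in_boundary m) n t /\ R n t y.
(* By this closure, an undefined parent has an undefined face opposite [(mid, p)], so that filling
   the horn attaches both at once. *)
pose parents_defined (U : graph grid X) :=
  forall k l (t : grid k) p (s : grid l), missing t -> tip t p ->
  defined U t -> (forall v, vertex_of s v -> vertex_of t v \/ v = (mid, p)) ->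
  defined U s.
pose P U := [/\ partial_map U, subgraph R0 U & parents_defined U].
have [||U [hU hU0 hUP] Umax] := @maximal_graph _ _ P R0.
- split=> //.
    apply: restrict_partial_map => //; apply: sieve_corner.
    exact: sieve_boundary.
  by move=> k l t p s ht _ [y [? _]].
- move=> F [V FV] PF cF; split.
  + by apply: union_partial_map => // W /PF [].
  + by move=> n t y h; exists V => //; have [_ + _] := PF V FV; apply.
  + move=> k l t p s ht tp [y [W FW h]] hs; have [_ _ hW] := PF W FW.
    have [|z hz] := hW k l t p s ht tp _ hs; first by exists y.
    by exists z, W.
have defK k (t : grid k) : ~ missing t -> defined U t.
  by move=> /contrapT h; have [y hy] := hd _ t h; exists y; apply: hU0.
have def k (s : grid k) p :
    nondeg s -> tip s p -> vertex_of s (mid, p) -> defined U s.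
  (* Lexicographic induction on (p, k): losing the vertex (0, p) lowers p. *)
  have [q] := ubnP (p : nat); elim: q k p s => // q IHq k.
  elim/ltn_ind: k => k IHk p s pq ns [[j0 e0] hp] [i0 ei].
  apply: contrapT => us.
  have ms : missing s by move=> h; apply: us; apply: defK.
  have /missingP [_ [p2 [j2 e2]] hb] := ms.
  (* The horn at [i0] is inner: [(ord0, p)] precedes [(mid, p)] and a vertex of row 2 follows it. *)
  have i00 : 0 < i0.
    apply: (@leq_trans j0.+1) => //; apply: (@hom_lt _ _ s.1).
    by case: e0 ei => -> _ [-> _].
  have i0k : i0 < k.
    apply: (@leq_trans j2); last by rewrite -ltnS.
    apply: (@hom_lt _ _ s.1).
    by case: e2 ei => -> _ [-> _].
  have nhorn l (f : hom l k) : ~ in_horn i0 f -> forall v, vertex_of s v ->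
      @vertex_of l (act f s) v \/ v = (mid, p).
    move=> nf v [j <-]; have [->|ji] := eqVneq j i0; first by right.
    have [|a <-] := @not_misses _ _ f j; last by left; exists a.
    by move=> h; apply: nf; exists j.
  (* The horn is exactly the part of [s] already defined. A missing simplex in the horn factors
     through its own parent [s']: a smaller tip is covered by [IHq]; with the same tip, [s'] is a
     proper face of [s], covered by [IHk]. *)
  have zd l (f : hom l k) : in_horn i0 f <-> defined U (yon s l f).
    split=> [[j ji hj]|df].
      have [mf|/defK //] := pselect (missing (yon s l f)).
      have [p' tf] := tip_exists mf.
      have [l' [s' [ns' hs']]] := parent_exists tf.
      have p'p : p' <= p by apply: hp; case: tf => [/vertex_act].
      have [h eh] : exists h, act f s = act h s'.
        by apply: nondeg_factor => // v hv; apply/hs'; left.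
      suff d : defined U s'.
        by change (defined U (act f s)); rewrite eh; exact: defined_act.
      have ts' : tip s' p'.
        case: tf => tf1 tf2; split=> [|r /hs' [/tf2 //|[]] //].
        by apply/hs'; left.
      have ms' : vertex_of s' (mid, p') by apply/hs'; right.
      move: p'p; rewrite leq_eqVlt => /orP[/eqP /val_inj e|p'p]; last first.
        by apply: IHq ns' ts' ms'; exact: leq_trans p'p _.
      subst p'; apply: (IHk l' _ p s' pq ns' ts' ms').
      have [g eg] : exists g, s' = act g s.
        apply: nondeg_factor => // v /hs' [/vertex_act //| ->].
        by exists i0.
      have gj : misses g j.
        move=> a; apply/eqP => ga; have : vertex_of s' (vtx s j).
          by exists a; rewrite eg -ga.
        move=> /hs' [[b] /ns fb|].
          by have := hj b; rewrite fb eqxx.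
        by rewrite -ei => /ns; apply/eqP.
      by move: ns'; rewrite eg; exact: nondeg_dim gj.
    (* Outside the horn only [(mid, p)] can be lost, so the simplex is missing with tip [p]; were it
       defined, [s] would be too. *)
    apply: contrapT => nf.
    have im0 := nhorn l f nf.
    have im1 v : vertex_of s v -> v.1 != mid -> @vertex_of l (act f s) v.
      by move=> /im0 [//| ->].
    apply: us; apply: (hUP _ _ (act f s) p s _ _ df im0).
      apply/missingP; split.
      - by exists p; apply: im1 => //; exists j0.
      - by exists p2; apply: im1 => //; exists j2.
      - move=> r; have [a /im0 [h|[_ ->]]] := hb r; first by exists a.
        by exists ord0; apply: im1 => //; exists j0.
    split; first by apply: im1 => //; exists j0.
    by move=> r /vertex_act; exact: hp.
  have zi l (f g : hom l k) : ~ in_horn i0 f -> ~ in_horn i0 g ->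
      yon s l f = yon s l g -> f = g.
    move=> _ _ e; apply: hom_eq => i; apply: ns.
    exact: (f_equal (fun t : grid l => vtx t i) e).
  have hk : 0 < i0 < k by rewrite i00.
  have [w hw] := attach hU (quasicat_extends hX hk) zd zi.
  set U' := join_graph _ _ in hw.
  have UU' : subgraph U U' by move=> *; left.
  have dU' (l : nat) (t : grid l) :
      (forall v, vertex_of t v -> vertex_of s v) -> defined U' t.
    move=> /(nondeg_factor ns) [f ->]; exists (w l f); right; by exists f.
  have [y hy] : defined U' s by apply: dU'.
  apply: us; exists y; apply: (Umax U' _ UU') hy.
  split=> //; first by move=> l t z /hU0 /UU'.
  move=> l l' t r s' mt tt dt hs'.
  (* Closure under parents survives: a newly attached chain lies outside the horn, so its tip is [p]
     and its parent has all its vertices in [s]. *)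
  have [d|nd] := pselect (defined U t).
    by have [x hx] := hUP _ _ t r s' mt tt d hs'; exists x; left.
  case: dt => z [hz|[f et _]]; first by case: nd; exists z.
  apply: dU' => v /hs' [|->].
    by rewrite et => /vertex_act.
  suff -> : r = p by exists i0.
  have nf : ~ in_horn i0 f by move/zd; rewrite -et.
  apply/val_inj/eqP; rewrite eqn_leq hp; last first.
    by case: tt; rewrite et => /vertex_act.
  case: tt => _; apply; rewrite et.
  by have [||] := nhorn l f nf (ord0, p); first by exists j0.
have [|w hw] := total_graph hU; last first.
  exists w => n t k; have [y hy] := hd n t k.
  by rewrite (pm_fun hU (hw n t) (hU0 _ _ _ (conj k hy))).
(* Every missing chain factors through its parent, which [def] covers. *)
move=> k t; have [mt|/defK //] := pselect (missing t).
have [p tp] := tip_exists mt; have [l [s [ns hs]]] := parent_exists tp.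
have [|f ->] := nondeg_factor ns (t := t).
  by move=> v hv; apply/hs; left.
apply: defined_act => //; apply: (def _ _ p) => //; last by apply/hs; right.
case: tp => t1 t2; split; first by apply/hs; left.
by move=> q /hs [/t2|[]].
Qed.

End Grid.

(** * Functor quasi-categories *)

Section Retract.
Variables (n : nat) (k : 'I_n.+1).

(* The inner horn on k is a retract of its corner with the horn of Delta 2,
   through j |-> (split_at j, j) and retract_at. *)
Definition split_at_fun (j : 'I_n.+1) : 'I_3 :=
  if j < k then ord0 else if j == k then mid else ord_max.

Lemma split_at_mono (i j : 'I_n.+1) :
  i <= j -> split_at_fun i <= split_at_fun j.
Proof.
rewrite /split_at_fun -!val_eqE; case: (ltngtP i k); case: (ltngtP j k) => //=.
all: lia.
Qed.

Definition split_at : hom n 2 := Hom split_at_mono.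

Definition retract_fun (c : 'I_3) (b : 'I_n.+1) : 'I_n.+1 :=
  if c == ord0 then (if b <= k then b else k)
  else if c == mid then k else (if k <= b then b else k).

Lemma retract_mono m (c : hom m 2) (b : hom m n) (i j : 'I_m.+1) :
  i <= j -> retract_fun (c i) (b i) <= retract_fun (c j) (b j).
Proof.
move=> ij; have := hmono c ij; have := hmono b ij.
rewrite /retract_fun; case: (c i) (c j) => [[|[|[|?]]] ?] [[|[|[|?]]] ?] //=.
all: by case: (leqP (b i) k); case: (leqP (b j) k);
  case: (leqP k (b i)); case: (leqP k (b j)) => //=; lia.
Qed.

Definition retract_at m (c : hom m 2) (b : hom m n) : hom m n :=
  Hom (@retract_mono m c b).

Lemma retract_split m (f : hom m n) : retract_at (comph split_at f) f = f.
Proof.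
apply: hom_eq => i; rewrite /= /retract_fun /split_at_fun.
case: (ltngtP (f i) k) => //= h.
- have -> : (f i == k) = false by rewrite -val_eqE /= gtn_eqF.
  by [].
- by rewrite (val_inj h) eqxx.
Qed.

(** Without row 0 all values are at least [k], so 0 is missed; without row 2 they are at most [k],
    so [n] is missed. A vertex other than [k] missed by [b] stays missed, each value being [k] or a
    value of [b]. *)
Lemma retract_horn m (c : hom m 2) (b : hom m n) : 0 < k < n ->
  in_horn mid c \/ in_horn k b -> in_horn k (retract_at c b).
Proof.
move=> /andP[k0 kn] [[j jm hj]|[j jk hj]]; last first.
  exists j => // i; have bj := hj i; rewrite /= /retract_fun.
  by repeat case: ifP => _; rewrite // eq_sym.
case: j jm hj => [[|[|[|?]]] jlt] // jm hj.
- exists ord0; first by rewrite -val_eqE /= eq_sym -lt0n.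
  move=> i; have := hj i; rewrite /= /retract_fun -!val_eqE /=.
  case: (c i) => [[|[|[|?]]] ?] //= _; first by rewrite -lt0n.
  by case: leqP => h; rewrite -lt0n //; apply: leq_trans h.
- exists ord_max; first by rewrite -val_eqE /= gtn_eqF.
  move=> i; have := hj i; rewrite /= /retract_fun -!val_eqE /=.
  case: (c i) => [[|[|[|?]]] ?] //= _; last by rewrite ltn_eqF.
  by case: leqP => h; rewrite ltn_eqF //; apply: leq_ltn_trans h _.
Qed.
End Retract.

(** The horn is transported to the corner by [retract_at], extended over the product of [Delta 2],
    [Delta n] and [K], and restricted along [split_at]. *)
Theorem Fun_quasicat (K X : sset) : quasicat X -> quasicat (Fun K X).
Proof.
move=> hX n k hk u.
pose R : graph (Prod (Delta 2) (Prod (Delta n) K)) X := fun i t d =>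
  exists h : in_horn k (retract_at k t.1 t.2.1),
    d = u i (exist _ _ h) i (idh i, t.2.2).
(* By naturality [u] is determined by its values at identity simplices, the only ones that enter
   [R]. *)
have u_act i j (g : hom i j) (x : horn k j) (y : K i) :
    u i (act g x) i (idh i, y) = u j x i (g, y).
  by rewrite app_nat.
have u_eq i (x x' : horn k i) (y : K i) :
    sval x = sval x' -> u i x i (idh i, y) = u i x' i (idh i, y).
  by move=> /sig_eq ->.
have hR : partial_map R.
  split=> [i j f t d [h ->]|i t d d' [h ->] [h' ->]].
    have h2 := @sieve_horn n k _ _ f _ h.
    exists h2.
    rewrite -app_nat /= -(u_act _ _ f); apply: u_eq.
    exact: hom_eq.
  exact: u_eq.
have [|||w hw] := @corner_extends (Prod (Delta n) K) X
    (fun i t => in_horn k t.1) _ _ R hR.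
- by move=> i j f t; exact: (@sieve_horn n k).
- by move=> m; exact: grid_corner_extends.
- move=> i t /(retract_horn hk) h.
  by exists (u i (exist _ _ h) i (idh i, t.2.2)), h.
pose t : Fun K X n := scomp w
  (spair (scomp (DeltaMap (split_at k)) (sfst (Delta n) K)) (sid _)).
exists (yon t); apply: smap_eq => m f; apply: smap_eq => i [g y] /=.
case: f => f hf /=.
have hi : in_horn k (comph f g) by exact: (@sieve_horn n k _ _ g _ hf).
have [|h ->] := hw i (comph (split_at k) (comph f g), (comph f g, y)).
  by right.
rewrite -(u_act _ _ g); apply: u_eq.
by rewrite /= retract_split.
Qed.

(** * Composition of edges *)

(** The cosimplicial identity, with [i'] and [j'] standing for [i] and [j - 1] in the smaller
    ordinal. *)
Lemma face_face n (i j : 'I_n.+3) (i' j' : 'I_n.+2) :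
  i < j -> i' = i :> nat -> j'.+1 = j :> nat ->
  comph (face j) (face i') = comph (face i) (face j').
Proof.
move=> ij ei ej; apply: hom_eq => a; apply: val_inj.
rewrite /= /bump ei -ej; move: ij; rewrite -ej.
by case: (leqP i a); case: (leqP j' a); case: leqP; case: leqP => //=; lia.
Qed.

(** A horn is glued from its faces along their pairwise intersections. *)
Lemma glue_horn (X : sset) n (k : 'I_n.+3) (t : 'I_n.+3 -> X n.+1) :
  quasicat X -> 0 < k < n.+2 ->
  (forall i j : 'I_n.+3, i < j -> i != k -> j != k ->
   forall i' j' : 'I_n.+2, i' = i :> nat -> j'.+1 = j :> nat ->
   act (face i') (t j) = act (face j') (t i)) ->
  exists w : X n.+2, forall j, j != k -> act (face j) w = t j.
Proof.
move=> hX hk ht.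
pose R : graph (Delta n.+2) X := fun m f x =>
  exists2 j, j != k & exists2 g, f = comph (face j) g & x = act g (t j).
have key m (g g' : hom m n.+1) (i j : 'I_n.+3) : i < j -> i != k -> j != k ->
    comph (face i) g = comph (face j) g' -> act g (t i) = act g' (t j).
  move=> ij ik jk e.
  have i'P : i < n.+2 by rewrite (leq_trans ij) // -ltnS.
  have j'P : j.-1 < n.+2 by have := ltn_ord j; lia.
  pose i' := Ordinal i'P; pose j' := Ordinal j'P.
  have ej : j'.+1 = j :> nat by rewrite /=; lia.
  (* A simplex in both faces misses [i] and [j], so it factors through the face of codimension 2. *)
  have [|g2 eg] := @misses_face _ _ g j'.
    move=> a; apply/eqP => ga.
    have := f_equal (fun h : hom _ _ => h a) e.
    rewrite /= ga => /(f_equal val) /= h.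
    have : nat_of_ord (lift j (g' a)) != j by rewrite eq_sym neq_lift.
    by rewrite /= -h /bump; lia.
  have eg' : g' = comph (face i') g2.
    apply: (@face_inj _ j); rewrite -e eg.
    have := @face_face n i j i' j' ij erefl ej.
    by move=> /(f_equal (fun h => comph h g2)).
  by rewrite eg eg' !act_comp (ht i j ij ik jk i' j').
have hR : partial_map R.
  split=> [l m f h x [j jk [g -> ->]]|m f x x' [i ik [g -> ->]] [j jk [g' e ->]]].
    by exists j => //; exists (comph g f); rewrite ?act_comp.
  case: (ltngtP i j) => [ij|ji|/val_inj ij]; first exact: key.
    by symmetry; exact: key.
  by subst j; rewrite (face_inj e).
have [|w hw] := quasicat_extends hX hk hR.
  move=> m f [j jk /misses_face [g ->]].
  by exists (act g (t j)), j => //; exists g.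
exists (w n.+2 (idh _)) => j jk; rewrite -app_nat /=.
apply: (pm_fun hR (x := face j)); last first.
  by exists j => //; exists (idh _) => //; rewrite act_id.
by apply: hw; exists j => // i; rewrite eq_sym neq_lift.
Qed.

Definition src (X : sset) (e : X 1) : X 0 := act (face ord_max) e.
Definition tgt (X : sset) (e : X 1) : X 0 := act (face ord0) e.

Lemma composes_src (X : sset) (f g h : X 1) : composes f g h -> src h = src f.
Proof.
move=> [t [<- _ <-]]; rewrite /src -!act_comp; congr (act _ t).
by apply: hom_eq => i; apply: val_inj; case: i => [[|[|i]] hi].
Qed.

Lemma composes_tgt (X : sset) (f g h : X 1) : composes f g h -> tgt h = tgt g.
Proof.
move=> [t [_ <- <-]]; rewrite /tgt -!act_comp; congr (act _ t).
by apply: hom_eq => i; apply: val_inj; case: i => [[|[|i]] hi].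
Qed.

Lemma composes_map (X Y : sset) (F : smap X Y) (f g h : X 1) :
  composes f g h -> composes (F 1 f) (F 1 g) (F 1 h).
Proof.
by move=> [t [<- <- <-]]; exists (F 2 t); rewrite !app_nat.
Qed.

Lemma src_map (X Y : sset) (F : smap X Y) (e : X 1) : src (F 1 e) = F 0 (src e).
Proof. by rewrite /src app_nat. Qed.

Lemma tgt_map (X Y : sset) (F : smap X Y) (e : X 1) : tgt (F 1 e) = F 0 (tgt e).
Proof. by rewrite /tgt app_nat. Qed.

Lemma id_edge_map (X Y : sset) (F : smap X Y) (x : X 0) :
  F 1 (id_edge x) = id_edge (F 0 x).
Proof. by rewrite /id_edge app_nat. Qed.

Lemma act_vertex (X : sset) (f : hom 0 0) (x : X 0) : act f x = x.
Proof.
have -> : f = idh 0 by apply: hom_eq => i; rewrite !ord1.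
exact: act_id.
Qed.

Lemma src_id (X : sset) (x : X 0) : src (id_edge x) = x.
Proof. by rewrite /src /id_edge -act_comp act_vertex. Qed.

Lemma tgt_id (X : sset) (x : X 0) : tgt (id_edge x) = x.
Proof. by rewrite /tgt /id_edge -act_comp act_vertex. Qed.

Lemma deg_l_mono (i j : 'I_3) : i <= j ->
  (if i <= 1 then ord0 else ord_max : 'I_2) <=
  (if j <= 1 then ord0 else ord_max : 'I_2).
Proof. by case: (leqP i 1); case: (leqP j 1) => //; lia. Qed.

Lemma deg_r_mono (i j : 'I_3) : i <= j ->
  (if i == ord0 then ord0 else ord_max : 'I_2) <=
  (if j == ord0 then ord0 else ord_max : 'I_2).
Proof. by rewrite -!val_eqE /=; case: eqP; case: eqP => //; lia. Qed.

(** The surjections collapsing the first and the last edge of the triangle give the unit laws and,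
    paired, the two triangles of a square. *)
Definition deg_l : hom 2 1 := Hom deg_l_mono.
Definition deg_r : hom 2 1 := Hom deg_r_mono.

Lemma deg_faces :
  [/\ comph deg_l (face ord_max) = consth 1 ord0,
      comph deg_l (face ord0) = idh 1
    & comph deg_l (face (lift ord0 ord0)) = idh 1] /\
  [/\ comph deg_r (face ord_max) = idh 1,
      comph deg_r (face ord0) = consth 1 ord_max
    & comph deg_r (face (lift ord0 ord0)) = idh 1].
Proof.
by split; split; apply: hom_eq => i; apply: val_inj; case: i => [[|[|i]] hi].
Qed.

Lemma comph_face_const :
  comph (face ord_max) (consth 1 ord0) = consth 1 (@ord0 1) /\
  comph (face ord0) (consth 1 ord0) = consth 1 (@ord_max 1).
Proof.
by split; apply: hom_eq => i; apply: val_inj.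
Qed.

Lemma composes_id_l (X : sset) (f : X 1) : composes (id_edge (src f)) f f.
Proof.
have [[l0 l1 l2] _] := deg_faces; have [c0 _] := comph_face_const.
by exists (act deg_l f); rewrite /id_edge /src -!act_comp l0 l1 l2 c0 act_id.
Qed.

Lemma composes_id_r (X : sset) (f : X 1) : composes f (id_edge (tgt f)) f.
Proof.
have [_ [r0 r1 r2]] := deg_faces; have [_ c1] := comph_face_const.
by exists (act deg_r f); rewrite /id_edge /tgt -!act_comp r0 r1 r2 c1 act_id.
Qed.

Lemma ord3_ind (P : 'I_3 -> Prop) :
  P ord0 -> P mid -> P ord_max -> forall i, P i.
Proof.
move=> h0 h1 h2 i; case: (i) (erefl i) => [[|[|[|a]]] ha] // e.
- by have -> : Ordinal ha = ord0 by exact: val_inj.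
- by have -> : Ordinal ha = mid by exact: val_inj.
- by have -> : Ordinal ha = ord_max by exact: val_inj.
Qed.

Section Composition.
Variable X : sset.
Hypothesis hX : quasicat X.
Implicit Types f g h k l m : X 1.

Lemma composes_exists f g : tgt f = src g -> exists h, composes f g h.
Proof.
(* The value at [mid] is a placeholder: that face is absent from the horn. *)
move=> e; pose t (j : 'I_3) := if j == ord0 then g else f.
have [|w hw] := @glue_horn X 0 mid t hX isT.
  elim/ord3_ind; elim/ord3_ind => // _ _ _ i' j' ei [ej]; rewrite /t /=.
  have -> : i' = ord0 by exact: val_inj.
  have -> : j' = ord_max by exact: val_inj.
  exact: e.
by exists (act (face mid) w), w; split=> //; rewrite hw.
Qed.

Local Notation o4 i := (@Ordinal 4 i isT).

Lemma ord4_ind (P : 'I_4 -> Prop) :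
  P (o4 0) -> P (o4 1) -> P (o4 2) -> P (o4 3) -> forall i, P i.
Proof.
by move=> h0 h1 h2 h3 [[|[|[|[|i]]]] hi] //; rewrite (bool_irrelevance hi isT).
Qed.

Definition faces4 (t0 t1 t2 t3 : X 2) (j : 'I_4) : X 2 :=
  match val j with 0 => t0 | 1 => t1 | 2 => t2 | _ => t3 end.

(** The four triangles are the faces of a 3-simplex, and filling an inner horn of dimension 3
    supplies the one not given. *)
Lemma composes_assoc f g h k l m :
  composes f g h -> composes g k l -> (composes h k m <-> composes f l m).
Proof.
move=> [t3 [f3 g3 h3]] [t0 [k0 l0 m0]]; split=> [[t1 [h1 k1 m1]]|[t2 [f2 l2 m2]]].
(* Face 2 is the one to be found; the second [t1] is a placeholder for it. *)
- have [||w hw] := @glue_horn X 1 (o4 2) (faces4 t0 t1 t1 t3) hX; first by [].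
    elim/ord4_ind; elim/ord4_ind => // _ _ _;
    elim/ord3_ind => //; elim/ord3_ind => //= _ _;
    by rewrite /faces4 /= ?g3 ?k0 ?l0 ?k1 ?h3 ?h1.
  exists (act (face (o4 2)) w); rewrite -!act_comp; split.
  + by rewrite -(@face_face 1 (o4 2) (o4 3) ord_max ord_max) // act_comp hw.
  + by rewrite (@face_face 1 (o4 0) (o4 2) ord0 mid) // act_comp hw.
  + by rewrite (@face_face 1 (o4 1) (o4 2) mid mid) // act_comp hw.
(* Now face 1 is absent, and the first [t2] is the placeholder. *)
- have [||w hw] := @glue_horn X 1 (o4 1) (faces4 t0 t2 t2 t3) hX; first by [].
    elim/ord4_ind; elim/ord4_ind => // _ _ _;
    elim/ord3_ind => //; elim/ord3_ind => //= _ _;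
    by rewrite /faces4 /= ?g3 ?f3 ?k0 ?l0 ?m0 ?l2 ?f2.
  exists (act (face (o4 1)) w); rewrite -!act_comp; split.
  + by rewrite -(@face_face 1 (o4 1) (o4 3) mid ord_max) // act_comp hw.
  + by rewrite (@face_face 1 (o4 0) (o4 1) ord0 ord0) // act_comp hw.
  + by rewrite -(@face_face 1 (o4 1) (o4 2) mid mid) // act_comp hw.
Qed.

End Composition.

Arguments composes_assoc [X] hX [f g h k l m].

(** * Adjunctions *)

(** Equality of morphisms in the homotopy category. *)
Definition homotopic (X : sset) (f g : X 1) := composes f (id_edge (tgt f)) g.

Section Homotopy.
Variable X : sset.
Hypothesis hX : quasicat X.
Implicit Types f g h : X 1.

(** Associativity with the unit triangle of [g] turns the second composite into a homotopy. *)
Lemma composes_unique f g h h' :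
  composes f g h -> composes f g h' -> homotopic h h'.
Proof.
move=> t t'; rewrite /homotopic (composes_tgt t).
exact/(composes_assoc hX t (composes_id_r g)).
Qed.

Lemma composes_homotopic f g h h' :
  composes f g h -> homotopic h h' -> composes f g h'.
Proof.
move=> t; rewrite /homotopic (composes_tgt t).
by move/(composes_assoc hX t (composes_id_r g)).
Qed.

Lemma homotopic_sym f g : homotopic f g -> homotopic g f.
Proof. by move=> h; exact: composes_unique h (composes_id_r f). Qed.

End Homotopy.

Lemma vert_functor_of (X Y : sset) (F : Fun X Y 0) : vert (functor_of F) = F.
Proof.
apply: smap_eq => n [t x] /=; congr (F _ (_, _)).
by apply: hom_eq => i; rewrite !ord1.
Qed.

Lemma precomp_comp (X Y Z D : sset) (g : smap Y Z) (f : smap X Y) n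
    (h : Fun Z D n) :
  precomp (scomp g f) D n h = precomp f D n (precomp g D n h).
Proof. exact: smap_eq. Qed.

Lemma precomp_vert (X Y D : sset) (f : smap X Y) (g : smap Y D) :
  precomp f D 0 (vert g) = vert (scomp g f).
Proof. exact: smap_eq. Qed.

Lemma postcomp_vert (X Y D : sset) (f : smap X Y) (g : smap Y D) :
  postcomp X g 0 (vert f) = vert (scomp g f).
Proof. exact: smap_eq. Qed.

Lemma precomp_postcomp (X Y Z D : sset) (g : smap Z D) (f : smap X Y) n
    (h : Fun Y Z n) :
  precomp f D n (postcomp Y g n h) = postcomp X g n (precomp f Z n h).
Proof. exact: smap_eq. Qed.

Section Naturality.
Variables (W X Y : sset) (e : Fun X Y 1) (c : Fun W X 1).

(** The pair [(e, c)] defines a square in [Fun W Y]; this is its value on the simplex [(p, q)] of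
    the product of two copies of [Delta 1]. *)
Program Definition whisker n (p q : hom n 1) : Fun W Y n :=
  @SMap (Prod (Delta n) W) Y
    (fun k t => e k (comph p t.1, c k (comph q t.1, t.2))) _.
Next Obligation. by rewrite -app_nat /= -(app_nat c). Qed.

Lemma act_whisker m n (p q : hom n 1) (f : hom m n) :
  act f (whisker p q) = whisker (comph p f) (comph q f).
Proof. exact: smap_eq. Qed.

(** The diagonal of the square serves as [d], and the two triangles it bounds are the two
    composites. *)
Lemma naturality (F G : smap X Y) (x x' : smap W X) :
  src e = vert F -> tgt e = vert G -> src c = vert x -> tgt c = vert x' ->
  exists d, composes (precomp x Y 1 e) (postcomp W G 1 c) d /\
            composes (postcomp W F 1 c) (precomp x' Y 1 e) d.
Proof.
move=> eF eG cx cx'; have [[l0 l1 l2] [r0 r1 r2]] := deg_faces.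
have const_val (Z T : sset) (h : Fun Z T 1) (i : 'I_2) j (u : smap Z T) :
    (forall n, comph (face j) (consth n ord0) = consth n i) ->
    act (face j) h = vert u -> forall k (s : hom k 1) z,
    h k (comph (consth 1 i) s, z) = u k z.
  move=> ij hu k s z.
  have := f_equal (fun v : Fun Z T 0 => v k (consth k ord0, z)) hu.
  by rewrite /= ij.
have f0 n : comph (face ord_max) (consth n ord0) = consth n (@ord0 1).
  by apply: hom_eq => i; apply: val_inj.
have f1 n : comph (face ord0) (consth n ord0) = consth n (@ord_max 1).
  by apply: hom_eq => i; apply: val_inj.
exists (whisker (idh 1) (idh 1)); split.
- exists (whisker deg_r deg_l); rewrite !act_whisker l0 l1 l2 r0 r1 r2.
  split=> //; apply: smap_eq => k [s w] /=.
    by rewrite (const_val _ _ _ _ _ _ f0 cx).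
  by rewrite (const_val _ _ _ _ _ _ f1 eG).
- exists (whisker deg_l deg_r); rewrite !act_whisker l0 l1 l2 r0 r1 r2.
  split=> //; apply: smap_eq => k [s w] /=.
    by rewrite (const_val _ _ _ _ _ _ f0 eF).
  by rewrite (const_val _ _ _ _ _ _ f1 cx').
Qed.
End Naturality.

Section Adjunction.
Variables (X Y : sset) (f : smap X Y) (g : smap Y X).
Hypotheses (hX : quasicat X) (hY : quasicat Y).
Variables (eta : Fun X X 1) (eps : Fun Y Y 1).
Hypotheses (etaP : is_edge (vert (sid X)) (vert (scomp g f)) eta)
  (epsP : is_edge (vert (scomp f g)) (vert (sid Y)) eps)
  (tri_f : composes (postcomp X f 1 eta) (precomp f Y 1 eps)
                    (id_edge (vert f)))
  (tri_g : composes (precomp g X 1 eta) (postcomp Y g 1 eps)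
                    (id_edge (vert g))).
Variables (W : sset) (a : smap W X).

(** The transpose is the image of [c] under [f] followed by the counit at [b]; naturality of [eta]
    along [c] and the triangle identity for [g] give back [c]. *)
Lemma transpose_exists (b : smap W Y) (c : Fun W X 1) :
  src c = vert a -> tgt c = vert (scomp g b) ->
  exists d : Fun W Y 1, [/\ src d = vert (scomp f a), tgt d = vert b
    & composes (precomp a X 1 eta) (postcomp W g 1 d) c].
Proof.
move=> ca cb; have hWX := @Fun_quasicat W X hX.
have hWY := @Fun_quasicat W Y hY.
have [eta_s eta_t] := etaP; have [eps_s eps_t] := epsP.
have fc_t : tgt (postcomp W f 1 c) = vert (scomp (scomp f g) b).
  by rewrite tgt_map cb postcomp_vert; congr vert; exact: smap_eq.
have eb_s : src (precomp b Y 1 eps) = vert (scomp (scomp f g) b).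
  by rewrite src_map [src eps]eps_s precomp_vert.
have [d hd] := composes_exists hWY (etrans fc_t (esym eb_s)).
exists d; split.
- by rewrite (composes_src hd) src_map ca postcomp_vert.
- rewrite (composes_tgt hd) tgt_map [tgt eps]eps_t precomp_vert.
  by congr vert; exact: smap_eq.
have [o [o1 o2]] := naturality eta_s eta_t ca cb.
have sidc : postcomp W (sid X) 1 c = c by exact: smap_eq.
rewrite sidc precomp_comp in o2.
have t := composes_map (precomp b X) tri_g.
rewrite id_edge_map precomp_vert -cb in t.
have o3 : composes o (precomp b X 1 (postcomp Y g 1 eps)) c.
  by apply/(composes_assoc hWX o2 t); exact: composes_id_r.
have gd := composes_map (postcomp W g) hd.
have egf : postcomp W (scomp g f) 1 c = postcomp W g 1 (postcomp W f 1 c).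
  exact: smap_eq.
rewrite egf in o1; rewrite precomp_postcomp in o3.
exact/(composes_assoc hWX o1 gd).
Qed.

(** By naturality of [eps] and the triangle identity for [f], every solution is homotopic to the
    explicit transpose [r] of [c]. *)
Lemma transpose_unique (c : Fun W X 1) (d d' : Fun W Y 1) :
  src d = vert (scomp f a) -> src d' = src d -> tgt d = tgt d' ->
  composes (precomp a X 1 eta) (postcomp W g 1 d) c ->
  composes (precomp a X 1 eta) (postcomp W g 1 d') c -> homotopic d d'.
Proof.
move=> ds ds' dt; have hWY := @Fun_quasicat W Y hY.
have [eta_s eta_t] := etaP; have [eps_s eps_t] := epsP.
pose b := functor_of (tgt d).
have fc_t h : tgt h = tgt d ->
    composes (precomp a X 1 eta) (postcomp W g 1 h) c ->
    tgt (postcomp W f 1 c) = src (precomp b Y 1 eps).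
  move=> ht /composes_tgt hc.
  rewrite tgt_map hc tgt_map ht src_map [src eps]eps_s precomp_vert.
  rewrite -[tgt d]vert_functor_of -/b !postcomp_vert.
  by congr vert; exact: smap_eq.
move=> hd hd'; have [r hr] := composes_exists hWY (fc_t d erefl hd).
have key h : src h = vert (scomp f a) -> tgt h = tgt d ->
    composes (precomp a X 1 eta) (postcomp W g 1 h) c ->
    composes (id_edge (vert (scomp f a))) h r.
  move=> hs ht hc.
  have [o [o1 o2]] := naturality eps_s eps_t hs
    (etrans ht (esym (vert_functor_of (tgt d)))).
  have sidh : postcomp W (sid Y) 1 h = h by exact: smap_eq.
  rewrite sidh precomp_comp in o1.
  have t := composes_map (precomp a Y) tri_f.
  rewrite id_edge_map precomp_vert precomp_postcomp in t.
  apply/(composes_assoc hWY t o1).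
  have fg : postcomp W (scomp f g) 1 h = postcomp W f 1 (postcomp W g 1 h).
    exact: smap_eq.
  rewrite fg in o2.
  exact/(composes_assoc hWY (composes_map (postcomp W f) hc) o2).
have homot h : src h = vert (scomp f a) -> tgt h = tgt d ->
    composes (precomp a X 1 eta) (postcomp W g 1 h) c -> homotopic h r.
  move=> hs ht hc; apply: (composes_unique hWY _ (key h hs ht hc)).
  by rewrite -hs; exact: composes_id_l.
apply: (composes_homotopic hWY (homot d ds erefl hd)).
apply: homotopic_sym => //.
exact: homot (etrans ds' ds) (esym dt) hd'.
Qed.
End Adjunction.

(** * Universal edges *)

(* l is a left Kan extension of src eta along p, with unit eta, at the level of
   homotopy categories. *)
Record universal (V W : sset) (p : smap V W) (X : sset) (eta : Fun V X 1)
    (l : Fun W X 0) : Prop := Universal {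
  univ_tgt : tgt eta = precomp p X 0 l;
  univ_exists : forall b c, src c = src eta -> tgt c = precomp p X 0 b ->
    exists d, [/\ src d = l, tgt d = b & composes eta (precomp p X 1 d) c];
  univ_unique : forall c d d', src d = l -> src d' = l -> tgt d = tgt d' ->
    composes eta (precomp p X 1 d) c -> composes eta (precomp p X 1 d') c ->
    homotopic d d' }.

(** Each composite of the two comparison edges solves the same factorisation problem as an identity
    edge. *)
Lemma universal_equiv (V W : sset) (p : smap V W) (X : sset) eta eta' l l' :
  quasicat X -> universal p (X := X) eta l -> universal p eta' l' ->
  src eta = src eta' -> exists e, is_equiv l l' e.
Proof.
move=> hX.
have half eta1 eta2 l1 l2 d d' : universal p (X := X) eta1 l1 ->
    src d = l1 -> tgt d = l2 -> src d' = l2 -> tgt d' = l1 ->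
    composes eta1 (precomp p X 1 d) eta2 ->
    composes eta2 (precomp p X 1 d') eta1 -> composes d d' (id_edge l1).
  move=> u1 ds dt ds' dt' hd hd'.
  have hW := @Fun_quasicat W X hX; have hV := @Fun_quasicat V X hX.
  have [k hk] := composes_exists hW (etrans dt (esym ds')).
  apply: (composes_homotopic hW hk).
  apply: (univ_unique u1 (c := eta1)); rewrite ?src_id ?tgt_id //.
  - by rewrite (composes_src hk).
  - by rewrite (composes_tgt hk).
  - by apply/(composes_assoc hV hd (composes_map (precomp p X) hk)).
  - by rewrite id_edge_map -(univ_tgt u1); exact: composes_id_r.
move=> u u' e.
have [d [ds dt hd]] := univ_exists u (esym e) (univ_tgt u').
have [d' [ds' dt' hd']] := univ_exists u' e (univ_tgt u).
exists d; split; first by split.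
exists d'; split; first by split.
  exact: (half _ _ _ _ _ _ u ds dt ds' dt' hd hd').
exact: (half _ _ _ _ _ _ u' ds' dt' ds dt hd' hd).
Qed.

Lemma universal_comp (V U W : sset) (p : smap V U) (q : smap U W) (X : sset)
    eta1 l1 eta2 l2 eta :
  quasicat X -> universal p (X := X) eta1 l1 -> universal q eta2 l2 ->
  src eta2 = l1 -> composes eta1 (precomp p X 1 eta2) eta ->
  universal (scomp q p) eta l2.
Proof.
move=> hX u1 u2 e2 he; have hV := @Fun_quasicat V X hX.
have hU := @Fun_quasicat U X hX.
split=> [|b c cs ct|c d d' ds ds' dt].
- by rewrite (composes_tgt he) tgt_map (univ_tgt u2) precomp_comp.
- rewrite precomp_comp in ct; rewrite (composes_src he) in cs.
  have [d1 [d1s d1t hd1]] := univ_exists u1 cs ct.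
  have [d2 [d2s d2t hd2]] := univ_exists u2 (etrans d1s (esym e2)) d1t.
  exists d2; split=> //; rewrite precomp_comp.
  exact/(composes_assoc hV he (composes_map (precomp p X) hd2)).
(* Factoring [c] through [eta] by [h] amounts to factoring it through [eta1] by [k], the composite
   of [eta2] with the pullback of [h]. Uniqueness for [eta1] and then for [eta2] applies. *)
- have split_edge h : src h = l2 ->
      composes eta (precomp (scomp q p) X 1 h) c ->
      exists2 k, composes eta2 (precomp q X 1 h) k &
        composes eta1 (precomp p X 1 k) c.
    move=> hs; rewrite precomp_comp => hc.
    have [|k hk] := @composes_exists _ hU eta2 (precomp q X 1 h).
      by rewrite (univ_tgt u2) src_map hs.
    exists k => //.
    exact/(composes_assoc hV he (composes_map (precomp p X) hk)).
  move=> /(split_edge _ ds) [k hk ck] /(split_edge _ ds') [k' hk' ck'].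
  apply: (univ_unique u2 ds ds' dt (c := k')) => //.
  apply: (composes_homotopic hU hk); apply: (univ_unique u1 _ _ _ ck ck').
  + by rewrite (composes_src hk).
  + by rewrite (composes_src hk').
  + by rewrite (composes_tgt hk) (composes_tgt hk') !tgt_map dt.
Qed.

Lemma universal_iso (V' V W : sset) (f : smap V' V) (g : smap V V')
    (p : smap V W) (X : sset) eta l :
  scomp f g = sid V -> scomp g f = sid V' -> universal p (X := X) eta l ->
  universal (scomp p f) (precomp f X 1 eta) l.
Proof.
move=> fg gf u.
have pid n (Z : sset) (h : Fun Z X n) : precomp (sid Z) X n h = h.
  by apply: smap_eq => k [].
have fK n (h : Fun V X n) : precomp g X n (precomp f X n h) = h.
  by rewrite -precomp_comp fg pid.
have gK n (h : Fun V' X n) : precomp f X n (precomp g X n h) = h.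
  by rewrite -precomp_comp gf pid.
split=> [|b c cs ct|c d d' ds ds' dt].
- by rewrite precomp_comp -(univ_tgt u) tgt_map.
- have [||d [ds dt hd]] := @univ_exists _ _ _ _ _ _ u b (precomp g X 1 c).
  + by rewrite src_map cs src_map fK.
  + by rewrite tgt_map ct precomp_comp fK.
  exists d; split=> //; rewrite precomp_comp -[c]gK.
  exact: composes_map.
- rewrite !precomp_comp => /(composes_map (precomp g X)) h.
  move=> /(composes_map (precomp g X)); move: h; rewrite !fK.
  exact: (univ_unique u).
Qed.

(** * Currying, and colimits as universal edges *)

Section Uncurry.
Variables W B X : sset.

Lemma uncurry_nat n (h : Fun W (Fun B X) n) j k (f : hom j k)
    (t : Prod (Delta n) (Prod W B) k) :
  h j (comph t.1 f, act f t.2.1) j (idh j, act f t.2.2) =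
  act f (h k (t.1, t.2.1) k (idh k, t.2.2)).
Proof. by rewrite -app_nat (app_nat h f (t.1, t.2.1)). Qed.

Definition uncurry_simplex n (h : Fun W (Fun B X) n) : Fun (Prod W B) X n :=
  @SMap (Prod (Delta n) (Prod W B)) X
    (fun k t => h k (t.1, t.2.1) k (idh k, t.2.2)) (uncurry_nat h).

Program Definition uncurry : smap (Fun W (Fun B X)) (Fun (Prod W B) X) :=
  @SMap (Fun W (Fun B X)) (Fun (Prod W B) X) (fun n h => uncurry_simplex h) _.
Next Obligation. exact: smap_eq. Qed.

Lemma curryK n (h : Fun (Prod W B) X n) : uncurry n (curry W B X n h) = h.
Proof. by apply: smap_eq => k [t [w b]] /=; rewrite act_id. Qed.

Lemma uncurryK n (h : Fun W (Fun B X) n) : curry W B X n (uncurry n h) = h.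
Proof.
apply: smap_eq => k [t w]; apply: smap_eq => j [s b] /=.
by rewrite (app_nat h s (t, w)).
Qed.

(** This turns the adjunction of a colimit functor with [diagonal] into universality along the
    projection [sfst]. *)
Lemma curry_precomp_fst n (h : Fun W X n) :
  curry W B X n (precomp (sfst W B) X n h) = postcomp W (diagonal B X) n h.
Proof.
apply: smap_eq => k [t w]; apply: smap_eq => j [s b] /=.
by rewrite -(app_nat h s (t, w)).
Qed.

Lemma curry_inj n : injective (curry W B X n).
Proof. by move=> h h' /(f_equal (uncurry n)); rewrite !curryK. Qed.

Definition curry_map (a : smap (Prod W B) X) : smap W (Fun B X) :=
  functor_of (curry W B X 0 (vert a)).

Lemma curry_vert a : curry W B X 0 (vert a) = vert (curry_map a).
Proof. by rewrite vert_functor_of. Qed.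
End Uncurry.

(** The universal edge is the unit of the adjunction, restricted along [curry_map a] and uncurried;
    its universality is transposition over [W]. *)
Lemma colimit_universal (B X W : sset) (colim : smap (Fun B X) X)
    (a : smap (Prod W B) X) :
  quasicat X -> colimit_functor colim ->
  exists2 eta, src eta = vert a &
    universal (sfst W B) eta (vert (scomp colim (curry_map a))).
Proof.
move=> hX [eta [eps [etaP epsP tri_f tri_g]]].
have hB := @Fun_quasicat B X hX.
pose e := precomp (curry_map a) (Fun B X) 1 eta.
have ce : curry W B X 1 (uncurry W B X 1 e) = e by exact: uncurryK.
have es : src e = vert (curry_map a).
  rewrite src_map [src eta](proj1 etaP) precomp_vert.
  by congr vert; exact: smap_eq.
have et : tgt e =
    postcomp W (diagonal B X) 0 (vert (scomp colim (curry_map a))).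
  rewrite tgt_map [tgt eta](proj2 etaP) precomp_vert postcomp_vert.
  by congr vert; exact: smap_eq.
have us : src (uncurry W B X 1 e) = vert a.
  by apply: curry_inj; rewrite -src_map ce es curry_vert.
exists (uncurry W B X 1 e) => //; split.
- by apply: curry_inj; rewrite -tgt_map ce et curry_precomp_fst.
- move=> b c cs ct.
  have [||d [ds dt hd]] := @transpose_exists _ _ _ _ hB hX eta eps etaP epsP
    tri_g W (curry_map a) (functor_of b) (curry W B X 1 c).
  + by rewrite src_map cs us curry_vert.
  + by rewrite tgt_map ct curry_precomp_fst -postcomp_vert vert_functor_of.
  exists d; split=> //; first by rewrite dt vert_functor_of.
  have -> : precomp (sfst W B) X 1 d =
      uncurry W B X 1 (postcomp W (diagonal B X) 1 d).
    by apply: curry_inj; rewrite uncurryK curry_precomp_fst.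
  by rewrite -[c]curryK; exact: composes_map.
- move=> c d d' ds ds' dt /(composes_map (curry W B X)) h.
  move=> /(composes_map (curry W B X)); move: h.
  rewrite ce !curry_precomp_fst => h h'.
  by apply: (transpose_unique hX etaP epsP tri_f ds _ dt h h'); rewrite ds'.
Qed.

(** * Iterated coends *)

Program Definition eval_at (Z X : sset) (z : Z 0) : smap (Fun Z X) X :=
  @SMap (Fun Z X) X (fun n h => h n (idh n, act (consth n ord0) z)) _.
Next Obligation. by rewrite -app_nat /= -act_comp. Qed.

Lemma is_equiv_map (X Y : sset) (F : smap X Y) x y e :
  is_equiv x y e -> is_equiv (F 0 x) (F 0 y) (F 1 e).
Proof.
have edge a b c : is_edge a b c -> is_edge (F 0 a) (F 0 b) (F 1 c).
  by move=> [<- <-]; split; rewrite app_nat.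
move=> [xy [e' [yx h h']]]; split; first exact: edge.
exists (F 1 e'); rewrite -!id_edge_map; split; first exact: edge.
  exact: composes_map.
exact: composes_map.
Qed.

(** Evaluation at [vert F] is a functor, so it carries an equivalence to an equivalence between
    values. *)
Lemma equiv_naturally_isomorphic (X D : sset) (S T : smap (Fun X D) D) :
  (exists e, is_equiv (vert S) (vert T) e) -> naturally_isomorphic S T.
Proof.
move=> [e he]; exists e; split=> // F.
have evE (U : smap (Fun X D) D) : eval_at D (vert F) 0 (vert U) = U 0 (vert F).
  exact: (f_equal (U 0) (act_vertex _ (vert F))).
by have := is_equiv_map (eval_at D (vert F)) he; rewrite !evE.
Qed.

Definition fst2 (X Y W : sset) : smap (Prod (Prod X Y) W) X :=
  scomp (sfst X Y) (sfst (Prod X Y) W).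

(** Exchanging the last two factors lets both iterated coends be compared over one product. *)
Definition rotate (X Y W : sset) :
    smap (Prod (Prod X Y) W) (Prod (Prod X W) Y) :=
  spair (spair (@fst2 X Y W) (ssnd (Prod X Y) W))
    (scomp (ssnd X Y) (sfst (Prod X Y) W)).

Lemma rotateK (X Y W : sset) : scomp (rotate X W Y) (rotate X Y W) = sid _.
Proof. by apply: smap_eq => n [[x y] w]. Qed.

Lemma double_colimit_universal (A B X W : sset) (cA : smap (Fun A X) X)
    (cB : smap (Fun B X) X) (a : smap (Prod (Prod W A) B) X) :
  quasicat X -> colimit_functor cA -> colimit_functor cB ->
  exists2 eta, src eta = vert a &
    universal (fst2 W A B) eta
      (vert (scomp cA (curry_map (scomp cB (curry_map a))))).
Proof.
move=> hX hA hB.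
have [eta1 s1 u1] := colimit_universal a hX hB.
have [eta2 s2 u2] := colimit_universal (scomp cB (curry_map a)) hX hA.
have [|eta he] := composes_exists (@Fun_quasicat _ _ hX)
    (f := eta1) (g := precomp (sfst (Prod W A) B) X 1 eta2).
  by rewrite [LHS](univ_tgt u1) src_map s2.
exists eta; first by rewrite (composes_src he).
exact: (universal_comp hX u1 u2 s2 he).
Qed.

Section DoubleCoend.
Variables C E D : sset.
Hypothesis hD : quasicat D.
Variable colimC : smap (Fun (Tw C) D) D.
Variable colimE : smap (Fun (Tw E) D) D.
Variable colimCE : smap (Fun (Tw (Prod C E)) D) D.
Hypotheses (hC : colimit_functor colimC) (hE : colimit_functor colimE)
  (hCE : colimit_functor colimCE).

Local Notation Z := (Fun (Quad C E) D).

Lemma evaluate_nat m n (f : hom m n) (t : Prod (Prod Z (Tw C)) (Tw E) n) :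
  (act f t).1.1 m
    (idh m, (SigmaTw C m (act f t).1.2, SigmaTw E m (act f t).2)) =
  act f (t.1.1 n (idh n, (SigmaTw C n t.1.2, SigmaTw E n t.2))).
Proof.
have eC := app_nat (SigmaTw C) f t.1.2; have eE := app_nat (SigmaTw E) f t.2.
rewrite -app_nat; change (t.1.1 m (f, (SigmaTw C m (act f t.1.2),
  SigmaTw E m (act f t.2))) = t.1.1 m (f, (act f (SigmaTw C n t.1.2),
  act f (SigmaTw E n t.2)))).
by rewrite eC eE.
Qed.

Definition evaluate : smap (Prod (Prod Z (Tw C)) (Tw E)) D :=
  @SMap (Prod (Prod Z (Tw C)) (Tw E)) D
    (fun n t => t.1.1 n (idh n, (SigmaTw C n t.1.2, SigmaTw E n t.2)))
    evaluate_nat.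

Lemma iint_CE_universal : exists2 eta, src eta = vert evaluate &
  universal (fst2 Z (Tw C) (Tw E)) eta (vert (iint_CE colimC colimE)).
Proof.
have [eta s u] := double_colimit_universal evaluate hD hC hE; exists eta => //.
(* The identification with the iterated coend is strict, because [SigmaTw] commutes with restriction
   of simplices. *)
have <- : scomp colimC (curry_map (scomp colimE (curry_map evaluate))) =
    iint_CE colimC colimE; last exact: u.
apply: smap_eq => n F; congr (colimC n _); apply: smap_eq => k [t x].
congr (colimE k _); apply: smap_eq => j [r y].
transitivity (F j (comph t r, (SigmaTw C j (act r x), SigmaTw E j y))) => //.
by rewrite (app_nat (SigmaTw C) r x).
Qed.

Lemma iint_EC_universal : exists2 eta, src eta = vert evaluate &
  universal (fst2 Z (Tw C) (Tw E)) eta (vert (iint_EC colimC colimE)).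
Proof.
have [eta s u] := double_colimit_universal
  (scomp evaluate (rotate Z (Tw E) (Tw C))) hD hE hC.
(* Rotating the factors back gives an edge with source [vert evaluate], as for the other order. *)
exists (precomp (rotate Z (Tw C) (Tw E)) D 1 eta).
  by rewrite src_map s precomp_vert; congr vert; exact: smap_eq.
have <- : scomp colimE (curry_map (scomp colimC (curry_map
    (scomp evaluate (rotate Z (Tw E) (Tw C)))))) = iint_EC colimC colimE.
  apply: smap_eq => n F; congr (colimE n _); apply: smap_eq => k [t x].
  congr (colimC k _); apply: smap_eq => j [r y].
  transitivity (F j (comph t r, (SigmaTw C j y, SigmaTw E j (act r x)))) => //.
  by rewrite (app_nat (SigmaTw E) r x).
have <- : scomp (fst2 Z (Tw E) (Tw C)) (rotate Z (Tw C) (Tw E)) =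
    fst2 Z (Tw C) (Tw E) by exact: smap_eq.
exact: (universal_iso (rotateK _ _ _) (rotateK _ _ _) u).
Qed.

(** Simplices of [Tw (Prod C E)] are already pairs, so this only rebrackets. *)
Program Definition tw_prod : smap (Prod (Prod Z (Tw C)) (Tw E))
    (Prod Z (Tw (Prod C E))) :=
  @SMap (Prod (Prod Z (Tw C)) (Tw E)) (Prod Z (Tw (Prod C E)))
    (fun n t => (t.1.1, (t.1.2, t.2))) _.

Program Definition tw_prod_inv : smap (Prod Z (Tw (Prod C E)))
    (Prod (Prod Z (Tw C)) (Tw E)) :=
  @SMap (Prod Z (Tw (Prod C E))) (Prod (Prod Z (Tw C)) (Tw E))
    (fun n t => ((t.1, t.2.1), t.2.2)) _.

Lemma int_pair_universal : exists2 eta, src eta = vert evaluate &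
  universal (fst2 Z (Tw C) (Tw E)) eta (vert (int_pair colimCE)).
Proof.
have [eta s u] := colimit_universal (scomp evaluate tw_prod_inv) hD hCE.
exists (precomp tw_prod D 1 eta).
  rewrite src_map s precomp_vert; congr vert; apply: smap_eq => n [[F x] y].
  by [].
have <- : scomp colimCE (curry_map (scomp evaluate tw_prod_inv)) =
    int_pair colimCE.
  apply: smap_eq => n F; congr (colimCE n _); apply: smap_eq => k [t x].
  by [].
have <- : scomp (sfst Z (Tw (Prod C E))) tw_prod =
    fst2 Z (Tw C) (Tw E) by exact: smap_eq.
apply: (universal_iso (f := tw_prod) (g := tw_prod_inv) _ _ u).
  by apply: smap_eq => n [F [x y]].
by apply: smap_eq => n [[F x] y].
Qed.
End DoubleCoend.

Theorem theorem2p2 (C E D : sset)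
  (C_quasicat : quasicat C) (C_small : small C)
  (E_quasicat : quasicat E) (E_small : small E)
  (D_presentable : presentable D)
  (colimC : smap (Fun (Tw C) D) D)
  (colimE : smap (Fun (Tw E) D) D)
  (colimCE : smap (Fun (Tw (Prod C E)) D) D)
  (colimC_colimit : colimit_functor colimC)
  (colimE_colimit : colimit_functor colimE)
  (colimCE_colimit : colimit_functor colimCE) :
  naturally_isomorphic (iint_CE colimC colimE) (iint_EC colimC colimE) /\
  naturally_isomorphic (iint_EC colimC colimE) (int_pair colimCE) /\
  naturally_isomorphic (iint_CE colimC colimE) (int_pair colimCE).
Proof.
have [D_quasicat _ _] := D_presentable.
have [eta1 s1 u1] := iint_CE_universal D_quasicat colimC_colimit colimE_colimit.
have [eta2 s2 u2] := iint_EC_universal D_quasicat colimC_colimit colimE_colimit.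
have [eta3 s3 u3] := int_pair_universal D_quasicat colimCE_colimit.
(* The three universal edges share the source [vert evaluate], so their targets are equivalent. *)
split; [|split]; apply: equiv_naturally_isomorphic;
  apply: universal_equiv D_quasicat _ _ _; eassumption || by rewrite ?s1 ?s2.
Qed.
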